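(* Given a polygonal curve $\gamma$ in $\mathbb S^N$, for any integer $1\le j\le N-1$ one has $$\mathcal L_{\mathbb S^N}(\gamma)=\int_{G_{j+1}\mathbb R^{N+1}}\mathcal L_{\mathbb S^j_p}(\eta_p(\gamma))\,d\mu_{j+1}(p),\qquad \mathbf K_g(\gamma)=\int_{G_{j+1}\mathbb R^{N+1}}\mathbf K_g(\eta_p(\gamma))\,d\mu_{j+1}(p).$$
   Context: $N\ge2$; $\mathbb S^N$ is the unit sphere of $\mathbb R^{N+1}$. A polygonal curve in $\mathbb S^N$ is a curve made of finitely many consecutive geodesic arcs. $G_{j+1}\mathbb R^{N+1}$ is the Grassmannian of unoriented $(j+1)$-planes (linear subspaces) of $\mathbb R^{N+1}$, $\mu_{j+1}$ its rotationally invariant probability measure, and $\pi_p$ the orthogonal projection of $\mathbb R^{N+1}$ onto $p$. For $p\in G_{j+1}\mathbb R^{N+1}$, $\mathbb S^j_p:=\mathbb S^N\cap p$, and $\eta_p(x):=\pi_p(x)/|\pi_p(x)|$ is the nearest point to $x$ on $\mathbb S^j_p$, defined for $x\in\mathbb S^N$ not orthogonal to $p$. The projected curve $\eta_p(\gamma)$ is well-defined for $\mu_{j+1}$-a.e. $p$. $\mathcal L_{\mathbb S^N}$, $\mathcal L_{\mathbb S^j_p}$ denote length, and the geodesic rotation $\mathbf K_g(\gamma)$ of a polygonal curve in a sphere is the sum of the turning angles between consecutive geodesic arcs of $\gamma$. *)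

(* Defs.v *)
From HB Require Import structures.
From mathcomp Require Import all_boot all_order all_algebra.
From mathcomp Require Import all_classical all_reals all_analysis.

Set Implicit Arguments.
Unset Strict Implicit.
Unset Printing Implicit Defensive.

Import Order.TTheory GRing.Theory Num.Theory.
Import numFieldNormedType.Exports.

Local Open Scope classical_set_scope.
Local Open Scope ring_scope.

Section Euclidean.
Context {R : realType} {n : nat}.
Implicit Types (u v : 'rV[R]_n) (p : {vspace 'rV[R]_n}).

(* The norm `|u| provided by the library on 'rV[R]_n is the sup norm, hence
   the separate Euclidean norm. *)
Definition dot u v : R := (u *m v^T) 0 0.
Definition enorm u : R := Num.sqrt (dot u u).
Definition normalize u := (enorm u)^-1 *: u.

Definition angle u v : R := acos (dot u v / (enorm u * enorm v)).

(* The orthogonal projection pi_p. *)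
Definition oproj p u : 'rV[R]_n :=
  xget 0 [set v | v \in p /\ forall w, w \in p -> dot (u - v) w = 0].

(* The nearest-point map eta_p; it takes the value 0 at the vectors that are
   orthogonal to p, where it is mathematically undefined. *)
Definition sproj p u : 'rV[R]_n := normalize (oproj p u).

Definition rotation_mx (Q : 'M[R]_n) := Q *m Q^T = 1%:M /\ \det Q = 1.

End Euclidean.

Section Curves.
Context {R : realType} {n : nat}.
Implicit Types (c : R -> 'rV[R]_n) (a b s : R) (ts : seq R).

(* Length of c on [a, b] for the geodesic distance of the unit sphere, which
   is the angle.  Great subspheres are totally geodesic, so that the same
   distance serves in the sphere of R^n and in its intersection with p. *)
Definition curve_length a b c : \bar R :=
  ereal_sup [set (\sum_(0 <= i < size ts)
      angle (c (nth b (a :: ts) i)) (c (nth b (a :: ts) i.+1)))%:E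
    | ts in [set ts | itv_partition a b ts]].

(* An arc of a great circle, of any positive length, with an arbitrary monotone
   parametrization: eta_p changes the speed of a geodesic arc. *)
Definition geodesic_arc a b c := exists x y (theta : R -> R),
  [/\ enorm x = 1, enorm y = 1 & dot x y = 0] /\
  [/\ {within `[a, b], continuous theta},
      {in `[a, b] &, {homo theta : s t / s < t}} &
      forall s, s \in `[a, b] -> c s = cos (theta s) *: x + sin (theta s) *: y].

(* The arcs are the restrictions of c to the intervals of the partition
   a :: ts of [a, b]. *)
Definition polygonal a b c ts := itv_partition a b ts /\
  forall i, (i < size ts)%N ->
    geodesic_arc (nth b (a :: ts) i) (nth b (a :: ts) i.+1) c.

(* One-sided unit tangent vectors, as limits of directions of chords; they do
   not depend on the parametrization. *)
Definition tangent_left c s : 'rV[R]_n :=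
  lim (normalize (c s - c (s - h)) @[h --> 0^'+]).
Definition tangent_right c s : 'rV[R]_n :=
  lim (normalize (c (s + h) - c s) @[h --> 0^'+]).

Definition turning_angle c s : R := angle (tangent_left c s) (tangent_right c s).

(* b is the last element of ts, so that the sum is over the junctions of
   consecutive arcs. *)
Definition geodesic_rotation b c ts : R :=
  \sum_(s <- ts | s < b) turning_angle c s.

End Curves.

(* G_k R^n; the proof of k <= n ensures that it has a point. *)
Definition grassmannian (R : realType) (n k : nat) (kn : (k <= n)%N) :=
  {V : {vspace 'rV[R]_n} | \dim V == k}.

Section Grassmannian.
Context (R : realType) (n k : nat) (kn : (k <= n)%N).
Local Notation G := (grassmannian R kn).

HB.instance Definition _ := SubChoice.on G.

Lemma grassmannian_inhabited : exists V : {vspace 'rV[R]_n}, \dim V == k.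
Proof.
have := vbasisP {: 'rV[R]_n} => /andP[_].
set X := vbasis _; rewrite -(cat_take_drop k X) => /catl_free.
move=> /eqP dX; exists <<take k X>>%VS.
by rewrite dX size_take_min size_tuple dimvf /dim /= mul1n (minn_idPl kn).
Qed.

HB.instance Definition _ := isPointed.Build G
  (exist _ (xchoose grassmannian_inhabited) (xchooseP grassmannian_inhabited)).

Definition oproj_mx (p : G) : 'M[R]_n := lin1_mx (oproj (val p)).

(* The usual topology of the Grassmannian, for which p |-> pi_p is a
   homeomorphism onto the space of orthogonal projections of rank k, and its
   Borel sets. *)
HB.instance Definition _ := Topological.copy G (initial_topology oproj_mx).
HB.instance Definition _ := Measurable.copy G (g_sigma_algebraType (@open G)).

(* The default value p of insubd is never used when Q is invertible, see
   val_rotate. *)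
Definition rotate (Q : 'M[R]_n) (p : G) : G :=
  insubd p (linfun (mulmxr Q) @: val p)%VS.

Lemma val_rotate (Q : 'M[R]_n) (p : G) : rotation_mx Q ->
  val (rotate Q p) = (linfun (mulmxr Q) @: val p)%VS.
Proof.
move=> [QQ _]; rewrite val_insubd limg_dim_eq ?(valP p)//.
apply/eqP; rewrite -subv0; apply/subvP => v; rewrite memv_cap memv_ker memv0.
move=> /andP[_ /eqP]; rewrite lfunE /= => vQ.
by rewrite -[v]mulmx1 -QQ mulmxA vQ mul0mx.
Qed.

Definition rotation_invariant (mu : set G -> \bar R) :=
  forall Q : 'M[R]_n, rotation_mx Q ->
  forall A : set G, measurable A -> mu (rotate Q @^-1` A) = mu A.

End Grassmannian.

(* Main.v *)
Require Import Defs.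
From HB Require Import structures.
From mathcomp Require Import all_boot all_order all_algebra.
From mathcomp Require Import all_classical all_reals all_analysis.
From mathcomp Require Import measurable_realfun ring lra.

Set Implicit Arguments.
Unset Strict Implicit.
Unset Printing Implicit Defensive.

Import Order.TTheory GRing.Theory Num.Theory.
Import numFieldNormedType.Exports.

Local Open Scope classical_set_scope.
Local Open Scope ring_scope.

(** Both identities come from one averaging principle, [mean_angle_rproj]: for unit
    vectors [a] and [b] orthogonal to a fixed vector [v], the mean over [p] of the
    angle between the projections of [a] and [b] onto the intersection of [p] with
    the orthogonal complement of [v] is the angle between [a] and [b].

    Its proof uses invariance rather than integral geometry.  Let [c] be a great
    circle through [a] and [b] that is orthogonal to [v], and let [M s t] be the mean
    angle between the projections of [c s] and [c t].  The rotations of the plane of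
    [c] fix [v] and preserve the measure, so [M s t] depends on [t - s] only.  Linear
    maps send short arcs into the cone spanned by the images of their ends, so for
    almost every [p] the projected angles are additive along arcs shorter than [pi]
    ([angle_additive]), and [M] inherits this.  Projection commutes with the antipodal
    map, so [M s t + M s (t + pi) = pi].  A nonnegative function with these properties
    is [M 0 t = t] ([stationary_additive_id]).  The only planes to exclude are those
    where a given vector projects to [0]; they form a null set, again by rotation
    invariance ([rproj_eq0_ae_perp], [rproj_ae_neq0]).

    For lengths take [v = 0].  A polygon has a partition into arcs shorter than [pi]
    ([polygonal_short_arcs]).  The angle is additive on each of them, and also on its
    image under [sproj p] for almost every [p], so by the triangle inequality the
    length of the curve and that of its image are the sums of the angles over this
    same partition ([curve_length_chain]); the averaging principle is applied to each
    term.

    For rotations take for [v] a vertex of the polygon.  The tangents of the projected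
    curve at the image of [v] are the normalised projections of the tangents at [v] to
    the intersection of [p] with the orthogonal complement of [v] ([arc_tangent]), so
    that each turning angle is the mean of its projections. *)

(** * Angles between vectors *)

Section Arccosine.
Context {R : realType}.
Implicit Types a b c : R.

Lemma acos_le_add a b c : -1 <= a <= 1 -> -1 <= b <= 1 -> -1 <= c <= 1 ->
  a * b - c <= Num.sqrt (1 - a ^+ 2) * Num.sqrt (1 - b ^+ 2) ->
  acos c <= acos a + acos b.
Proof.
move=> a1 b1 c1 abc; have [|lt_pi] := leP pi (acos a + acos b).
  exact: le_trans (acos_lepi c1).
rewrite leNgt -ltr_cos ?in_itv/= ?(acos_ge0, acos_lepi, addr_ge0) ?(ltW lt_pi)//.
by rewrite -leNgt cosD !acosK ?in_itv//= !sin_acos//; lra.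
Qed.

Lemma acos_eq_add a b c : -1 <= a <= 1 -> -1 <= b <= 1 -> -1 <= c <= 1 ->
  0 <= a + b ->
  a * b - c = Num.sqrt (1 - a ^+ 2) * Num.sqrt (1 - b ^+ 2) ->
  acos c = acos a + acos b.
Proof.
move=> a1 b1 c1 ab0 abc; have lepi : acos a + acos b <= pi.
  rewrite -lerBrDr -acosN// leNgt -ltr_cos ?in_itv/= ?acos_ge0 ?acos_lepi//; try lra.
  rewrite -leNgt !acosK ?in_itv//=; lra.
apply: cos_inj; rewrite ?in_itv/= ?acos_ge0 ?acos_lepi ?addr_ge0 ?acos_ge0//.
rewrite cosD !acosK ?in_itv//= !sin_acos//; lra.
Qed.

Lemma cos_atan_gt0 a : 0 < cos (atan a).
Proof. by rewrite cos_gt0_pihalf// atan_gtNpi2 atan_ltpi2. Qed.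

Lemma sin_atan a : sin (atan a) = a * cos (atan a).
Proof. by rewrite -{2}(atanK a) /tan divfK// gt_eqF// cos_atan_gt0. Qed.

End Arccosine.

Section Dot.
Context {R : realType} {n : nat}.
Implicit Types (u v w : 'rV[R]_n) (k : R).

Lemma dotE u v : dot u v = \sum_i u 0 i * v 0 i.
Proof. by rewrite /dot mxE; apply: eq_bigr => i _; rewrite mxE. Qed.

Lemma dotC u v : dot u v = dot v u.
Proof. by rewrite !dotE; apply: eq_bigr => i _; rewrite mulrC. Qed.

Lemma dotDl u v w : dot (u + v) w = dot u w + dot v w.
Proof. by rewrite /dot mulmxDl mxE. Qed.

Lemma dotZl k u v : dot (k *: u) v = k * dot u v.
Proof. by rewrite /dot -scalemxAl mxE. Qed.

Lemma dotDr u v w : dot u (v + w) = dot u v + dot u w.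
Proof. by rewrite dotC dotDl !(dotC u). Qed.

Lemma dotZr k u v : dot u (k *: v) = k * dot u v.
Proof. by rewrite dotC dotZl dotC. Qed.

Lemma dotNl u v : dot (- u) v = - dot u v.
Proof. by rewrite -scaleN1r dotZl mulN1r. Qed.

Lemma dotNr u v : dot u (- v) = - dot u v.
Proof. by rewrite dotC dotNl dotC. Qed.

Lemma dot0l u : dot 0 u = 0.
Proof. by rewrite /dot mul0mx mxE. Qed.

Lemma dot0r u : dot u 0 = 0.
Proof. by rewrite dotC dot0l. Qed.

Definition dot_linear := (dotDl, dotDr, dotNl, dotNr, dotZl, dotZr, dot0l, dot0r).

Lemma dot_ge0 u : 0 <= dot u u.
Proof. by rewrite dotE sumr_ge0// => i _; rewrite -expr2 sqr_ge0. Qed.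

Lemma dot_eq0 u : (dot u u == 0) = (u == 0).
Proof.
apply/eqP/eqP => [|->]; last exact: dot0l.
rewrite dotE => /psumr_eq0P u0; apply/rowP => i; rewrite mxE; apply/eqP.
by rewrite -sqrf_eq0 expr2; apply/eqP/u0 => // j _; rewrite -expr2 sqr_ge0.
Qed.

Lemma dot_gt0 u : (0 < dot u u) = (u != 0).
Proof. by rewrite lt_def dot_eq0 dot_ge0 andbT. Qed.

Lemma dot_orthogonal (Q : 'M[R]_n) u v : Q *m Q^T = 1%:M ->
  dot (u *m Q) (v *m Q) = dot u v.
Proof. by move=> QQ; rewrite /dot trmx_mul mulmxA -(mulmxA u) QQ mulmx1. Qed.

Lemma sqr_enorm u : enorm u ^+ 2 = dot u u.
Proof. by rewrite sqr_sqrtr ?dot_ge0. Qed.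

Lemma enorm_eq1 u : (enorm u = 1) <-> (dot u u = 1).
Proof.
by split=> [e|e]; [rewrite -sqr_enorm e expr1n|rewrite /enorm e sqrtr1].
Qed.

Lemma enorm_gt0 u : (0 < enorm u) = (u != 0).
Proof. by rewrite sqrtr_gt0 dot_gt0. Qed.

Lemma cauchy_schwarz u v : dot u v ^+ 2 <= dot u u * dot v v.
Proof.
have [->|v0] := eqVneq v 0; first by rewrite !dot0r expr0n mulr0.
have := dot_ge0 (dot v v *: u - dot u v *: v).
rewrite !dot_linear (dotC v u); have := v0; rewrite -dot_gt0 => vv.
rewrite [X in 0 <= X](_ : _ = dot v v * (dot u u * dot v v - dot u v ^+ 2)); last by ring.
by rewrite pmulr_rge0// subr_ge0.
Qed.

Lemma normalize0 : normalize (0 : 'rV[R]_n) = 0.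
Proof. by rewrite /normalize scaler0. Qed.

Lemma dot_normalize u : dot (normalize u) (normalize u) = (u != 0)%:R.
Proof.
have [->|u0] := eqVneq u 0; first by rewrite normalize0 dot0l.
rewrite dotZl dotZr -sqr_enorm; have := u0; rewrite -enorm_gt0 => e.
by rewrite /=; field; rewrite gt_eqF.
Qed.

Lemma normalizeZ k u : 0 < k -> normalize (k *: u) = normalize u.
Proof.
move=> k0; have [->|u0] := eqVneq u 0; first by rewrite scaler0.
have e0 := u0; rewrite -enorm_gt0 in e0.
rewrite /normalize /enorm dotZl dotZr mulrA -expr2 sqrtrM ?sqr_ge0//.
rewrite sqrtr_sqr gtr0_norm// scalerA; congr (_ *: _); rewrite -/(enorm u).
by field; rewrite !gt_eqF.
Qed.

Lemma normalize_id u : dot u u = 1 -> normalize u = u.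
Proof. by rewrite /normalize => /enorm_eq1->; rewrite invr1 scale1r. Qed.

Lemma normalizeK u : normalize (normalize u) = normalize u.
Proof.
have [->|u0] := eqVneq u 0; first by rewrite !normalize0.
by rewrite {2}/normalize normalizeZ// invr_gt0 enorm_gt0.
Qed.

Lemma angleE u v : angle u v = acos (dot (normalize u) (normalize v)).
Proof.
by rewrite /angle dotZl dotZr; congr acos; rewrite invfM; ring.
Qed.

Lemma angle_normalize u v : angle (normalize u) (normalize v) = angle u v.
Proof. by rewrite !angleE !normalizeK. Qed.

Lemma dot_normalize_itv u v : -1 <= dot (normalize u) (normalize v) <= 1.
Proof.
rewrite -ler_norml -(expr_le1 (n := 2))// real_normK ?num_real//.
rewrite (le_trans (cauchy_schwarz _ _))// !dot_normalize.
by case: (u == 0); case: (v == 0); rewrite /= ?mulr1 ?mulr0 ?mul0r.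
Qed.

Lemma angleC u v : angle u v = angle v u.
Proof. by rewrite !angleE dotC. Qed.

Lemma angle_ge0 u v : 0 <= angle u v.
Proof. by rewrite angleE acos_ge0// dot_normalize_itv. Qed.

Lemma angle_lepi u v : angle u v <= pi.
Proof. by rewrite angleE acos_lepi// dot_normalize_itv. Qed.

Lemma angle_self u : u != 0 -> angle u u = 0.
Proof. by move=> u0; rewrite angleE dot_normalize u0 acos1. Qed.

Lemma angleNr u v : angle u (- v) = pi - angle u v.
Proof.
rewrite !angleE -acosN ?dot_normalize_itv//; congr acos.
by rewrite /normalize /enorm dotNl dotNr opprK -dotNr scalerN.
Qed.

Lemma gram_cauchy_schwarz u w v : dot v v = 1 ->
  (dot u w - dot u v * dot w v) ^+ 2 <=
  (dot u u - dot u v ^+ 2) * (dot w w - dot w v ^+ 2).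
Proof.
move=> vv; have := cauchy_schwarz (u - dot u v *: v) (w - dot w v *: v).
rewrite !dot_linear vv (dotC v u) (dotC v w).
rewrite [X in X ^+ 2 <= _](_ : _ = dot u w - dot u v * dot w v); last by ring.
by congr (_ <= _); ring.
Qed.

(** If [v = 0] both angles on the right are [pi / 2].  Otherwise, among unit
    vectors, the Cauchy-Schwarz inequality for the components of [u] and [w]
    orthogonal to [v] bounds the cosine of the left-hand side from below by that
    of the right-hand side. *)
Lemma angle_triangle u v w : angle u w <= angle u v + angle v w.
Proof.
rewrite !angleE; apply: acos_le_add; rewrite ?dot_normalize_itv//.
set u' := normalize u; set v' := normalize v; set w' := normalize w.
have [v0|v0] := eqVneq v 0.
  rewrite /v' v0 normalize0 dot0l dot0r expr0n subr0 sqrtr1 mulr1.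
  by rewrite mul0r sub0r lerNl; have /andP[] := dot_normalize_itv u w.
have vv : dot v' v' = 1 by rewrite /v' dot_normalize v0.
have le1 (x : 'rV[R]_n) : dot (normalize x) (normalize x) <= 1 :> R.
  by rewrite dot_normalize; case: (x == 0).
have cs := gram_cauchy_schwarz u' w' vv; rewrite (dotC v' w').
have pos (x : 'rV[R]_n) : 0 <= 1 - dot (normalize x) v' ^+ 2.
  by rewrite subr_ge0 (le_trans (cauchy_schwarz _ _))// vv mulr1.
have pos' (x : 'rV[R]_n) : 0 <= dot (normalize x) (normalize x) - dot (normalize x) v' ^+ 2.
  by rewrite subr_ge0 (le_trans (cauchy_schwarz _ _))// vv mulr1.
rewrite -sqrtrM ?pos// (le_trans (ler_norm _))// -sqrtr_sqr ler_wsqrtr//.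
rewrite -sqrrN opprB (le_trans cs)//.
by rewrite ler_pM ?pos'// lerB// ?le1.
Qed.

(** On unit vectors, with [v = a u + b w] and [c] the cosine of the angle from [u]
    to [w], the sines of the two angles on the right are [b] and [a] times
    [sqrt (1 - c^2)], so that the addition formula gives equality of cosines.
    Their cosines add up to [(a + b) (1 + c) >= 0], so the sum of the angles does
    not exceed [pi].  Parallel vectors are allowed, because the projections of the
    tangents at a vertex may fall on a line. *)
Lemma angle_additive (s t : R) u v w : 0 <= s -> 0 <= t ->
  u != 0 -> v != 0 -> w != 0 -> v = s *: u + t *: w ->
  angle u w = angle u v + angle v w.
Proof.
move=> s0 t0 u0 v0 w0 vE; rewrite !angleE.
set u' := normalize u; set v' := normalize v; set w' := normalize w.
have [uE vE' wE] : [/\ u = enorm u *: u', v = enorm v *: v' & w = enorm w *: w'].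
  by split; rewrite scalerA divff ?scale1r// gt_eqF// enorm_gt0.
move: u0 v0 w0; rewrite -!enorm_gt0 => u0 v0 w0.
have uu : dot u' u' = 1 by rewrite /u' dot_normalize -enorm_gt0 u0.
have vv : dot v' v' = 1 by rewrite /v' dot_normalize -enorm_gt0 v0.
have ww : dot w' w' = 1 by rewrite /w' dot_normalize -enorm_gt0 w0.
pose a := s * enorm u / enorm v; pose b := t * enorm w / enorm v.
have a0 : 0 <= a by rewrite !mulr_ge0 ?invr_ge0// ltW.
have b0 : 0 <= b by rewrite !mulr_ge0 ?invr_ge0// ltW.
have vE2 : v' = a *: u' + b *: w'.
  rewrite {1}/v' {1}/normalize [X in _ *: X = _]vE scalerDr.
  rewrite [X in s *: X]uE [X in t *: X]wE !scalerA /a /b.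
  by congr (_ *: _ + _ *: _); ring.
have c1 := dot_normalize_itv u w; rewrite -/u' -/w' in c1.
have [ruv rvw] := (dot_normalize_itv u v, dot_normalize_itv v w).
rewrite -/u' -/v' -/w' in ruv rvw; clearbody u' v' w'.
set c := dot u' w' in c1 *.
have uv : dot u' v' = a + b * c by rewrite vE2 !dot_linear uu -/c mulr1.
have vw : dot v' w' = a * c + b by rewrite vE2 !dot_linear ww -/c mulr1.
have n1 : a ^+ 2 + 2 * a * b * c + b ^+ 2 = 1.
  by rewrite -[RHS]vv vE2 !dot_linear uu ww (dotC w') -/c; ring.
apply: acos_eq_add => //.
  rewrite uv vw [X in 0 <= X](_ : _ = (a + b) * (1 + c)); last by ring.
  by apply: mulr_ge0; [exact: addr_ge0|case/andP: c1; clear; lra].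
have c2 : 0 <= 1 - c ^+ 2 by case/andP: c1; clear; nra.
rewrite uv vw.
have -> : 1 - (a + b * c) ^+ 2 = b ^+ 2 * (1 - c ^+ 2) by rewrite -{1}n1; ring.
have -> : 1 - (a * c + b) ^+ 2 = a ^+ 2 * (1 - c ^+ 2) by rewrite -{1}n1; ring.
rewrite (sqrtrM _ (sqr_ge0 a)) (sqrtrM _ (sqr_ge0 b)) !sqrtr_sqr !ger0_norm//.
rewrite mulrACA -expr2 sqr_sqrtr//.
by rewrite -[X in _ - X]mulr1 -[X in c * X]n1; ring.
Qed.

End Dot.

(** * Orthogonal projections and plane rotations *)

Section OrthogonalProjection.
Context {R : realType} {n : nat}.
Implicit Types (u v w : 'rV[R]_n) (p : {vspace 'rV[R]_n}).

(** Taking the dot products with a basis of [p] is a linear map which is injective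
    on [p], hence maps [p] onto all coordinate vectors, those of [u] included. *)
Lemma oproj_exists p u :
  exists v, v \in p /\ forall w, w \in p -> dot (u - v) w = 0.
Proof.
pose X := vbasis p; pose B : 'M[R]_(\dim p, n) := \matrix_i X`_i.
have BE v i : (v *m B^T) 0 i = dot v X`_i.
  by rewrite !mxE dotE; apply: eq_bigr => j _; rewrite !mxE.
pose f : 'Hom('rV[R]_n, 'rV[R]_(\dim p)) := linfun (mulmxr B^T).
have fE v : f v = v *m B^T by rewrite lfunE.
have perp v : f v = 0 -> forall w, w \in p -> dot v w = 0.
  move=> fv0 w /coord_vbasis ->; rewrite dotC.
  elim/big_ind: _ => [|a b a0 b0|i _]; rewrite ?dot_linear// ?a0 ?b0 ?addr0//.
  by rewrite dotC -BE -fE fv0 mxE mulr0.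
have cap : (p :&: lker f = 0)%VS.
  apply/eqP; rewrite -subv0; apply/subvP => v.
  rewrite memv_cap memv_ker memv0 => /andP[pv /eqP fv0].
  by rewrite -dot_eq0; apply/eqP/perp.
have /memv_imgP[v pv fv] : f u \in (f @: p)%VS.
  suff -> : (f @: p)%VS = fullv by exact: memvf.
  by apply/eqP; rewrite eqEdim subvf limg_dim_eq// dimvf /dim/= mul1n.
exists v; split=> // w pw; apply: perp pw.
by rewrite linearB/= fv subrr.
Qed.

Lemma oproj_mem p u : oproj p u \in p.
Proof. by rewrite /oproj; have [] := xgetPex 0 (oproj_exists p u). Qed.

Lemma oproj_perp p u w : w \in p -> dot (u - oproj p u) w = 0.
Proof. by rewrite /oproj; have [_] := xgetPex 0 (oproj_exists p u); apply. Qed.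

Lemma oproj_unique p u v :
  v \in p -> (forall w, w \in p -> dot (u - v) w = 0) -> oproj p u = v.
Proof.
move=> pv uv; apply/eqP; rewrite -subr_eq0 -dot_eq0.
have pd : oproj p u - v \in p by rewrite rpredB// oproj_mem.
have E : oproj p u - v = (u - v) - (u - oproj p u).
  by rewrite opprB [RHS]addrC addrA subrK.
by rewrite {1}E dotDl dotNl uv// oproj_perp// subrr.
Qed.

Lemma oproj_linear p k u v : oproj p (k *: u + v) = k *: oproj p u + oproj p v.
Proof.
apply: oproj_unique => [|w pw]; first by rewrite rpredD ?rpredZ ?oproj_mem.
by rewrite opprD addrACA -scalerBr dotDl dotZl !oproj_perp// mulr0 addr0.
Qed.

HB.instance Definition _ p := GRing.isLinear.Build R 'rV[R]_n 'rV[R]_n _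
  (oproj p) (oproj_linear p).

Lemma oproj_id p u : u \in p -> oproj p u = u.
Proof. by move=> pu; apply: oproj_unique => // w _; rewrite subrr dot0l. Qed.

Lemma dot_oproj p u v : dot (oproj p u) (oproj p v) = dot (oproj p u) v.
Proof.
apply/eqP; rewrite -subr_eq0 -dotNr -dotDr -oppr_eq0 -dotNr opprD opprK addrC.
by rewrite dotC oproj_perp ?oproj_mem.
Qed.

Lemma oproj_sym p u v : dot (oproj p u) v = dot (oproj p v) u.
Proof. by rewrite -dot_oproj dotC dot_oproj. Qed.

Lemma oproj_rotate (Q : 'M[R]_n) p u : Q *m Q^T = 1%:M ->
  oproj (linfun (mulmxr Q) @: p)%VS (u *m Q) = oproj p u *m Q.
Proof.
move=> QQ; have dotQ v w := dot_orthogonal v w QQ.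
apply: oproj_unique => [|w /memv_imgP[w' pw' ->]].
  by apply/memv_imgP; exists (oproj p u); rewrite ?oproj_mem// lfunE.
by rewrite lfunE/= -mulmxBl dotQ oproj_perp.
Qed.

End OrthogonalProjection.

Section PlaneRotation.
Context {R : realType} {n : nat}.
Implicit Types (u v x y : 'rV[R]_n) (s t : R).

(** Also used for the images [x] and [y] of an orthonormal pair under a projection,
    when it is an ellipse: it commutes with linear maps. *)
Definition circle x y t := cos t *: x + sin t *: y.

Lemma circle0 x y : circle x y 0 = x.
Proof. by rewrite /circle cos0 sin0 scale1r scale0r addr0. Qed.

Definition plane_rotation x y t : 'M[R]_n := \matrix_(i, j)
  ((i == j)%:R + x 0 i * ((cos t - 1) * x 0 j + sin t * y 0 j)
   + y 0 i * ((cos t - 1) * y 0 j - sin t * x 0 j)).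

Lemma mul_plane_rotation x y t u : u *m plane_rotation x y t =
  u + dot u x *: ((cos t - 1) *: x + sin t *: y)
    + dot u y *: ((cos t - 1) *: y - sin t *: x).
Proof.
apply/rowP => j; rewrite !mxE !dotE !mulr_suml.
rewrite [in RHS](_ : u 0 j = \sum_i u 0 i * (i == j)%:R); last first.
  rewrite (bigD1 j)//= eqxx mulr1 big1 ?addr0// => i /negbTE->.
  by rewrite mulr0.
by rewrite -!big_split/=; apply: eq_bigr => i _; rewrite !mxE; ring.
Qed.

Lemma angle_circle_add x y s t r : s <= t -> t <= r -> r - s < pi ->
  circle x y s != 0 -> circle x y t != 0 -> circle x y r != 0 ->
  angle (circle x y s) (circle x y r) =
  angle (circle x y s) (circle x y t) + angle (circle x y t) (circle x y r).
Proof.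
move=> st tr rs cs ct cr; have [rs0|rs0] := eqVneq s r.
  have -> : t = s by apply/eqP; rewrite eq_le st rs0 tr.
  by rewrite -rs0 angle_self// addr0.
have sin0 : 0 < sin (r - s).
  by rewrite sin_gt0_pi// rs andbT subr_gt0 lt_neqAle rs0 (le_trans st).
apply: (@angle_additive _ _ (sin (r - t) / sin (r - s)) (sin (t - s) / sin (r - s))) => //.
- by rewrite divr_ge0 ?(ltW sin0)// sin_ge0_pi//; lra.
- by rewrite divr_ge0 ?(ltW sin0)// sin_ge0_pi//; lra.
rewrite /circle !scalerDr !scalerA addrACA -!scalerDl.
have key (a b : R) : a * sin (r - s) = b -> a = b / sin (r - s).
  by move=> <-; rewrite mulfK// gt_eqF.
congr (_ *: _ + _ *: _).
  rewrite ![_ / _ * _]mulrAC -mulrDl; apply: key.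
  by rewrite !sinB; ring.
rewrite ![_ / _ * _]mulrAC -mulrDl; apply: key.
by rewrite !sinB; ring.
Qed.

Section Orthonormal.
Variables (x y : 'rV[R]_n).
Hypotheses (xx : dot x x = 1) (yy : dot y y = 1) (xy : dot x y = 0).

Lemma circle_unit t : dot (circle x y t) (circle x y t) = 1.
Proof.
rewrite /circle !dot_linear xx yy (dotC y) xy.
by rewrite -[RHS](cos2Dsin2 t); ring.
Qed.

Lemma plane_rotationD s t :
  plane_rotation x y s *m plane_rotation x y t = plane_rotation x y (s + t).
Proof.
apply/row_matrixP => i; rewrite !rowE mulmxA; move: (delta_mx 0 i) => u.
rewrite !mul_plane_rotation !dot_linear xx yy (dotC y x) xy cosD sinD.
by apply/rowP => j; rewrite !mxE; ring.
Qed.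

Lemma plane_rotation0 : plane_rotation x y 0 = 1%:M.
Proof.
by apply/matrixP => i j; rewrite !mxE cos0 sin0 subrr !mul0r oppr0 !addr0 !mulr0 !addr0.
Qed.

(** The determinant is [1] because a rotation is the square of the rotation by
    half its angle. *)
Lemma plane_rotation_rotation t : rotation_mx (plane_rotation x y t).
Proof.
have orth s : plane_rotation x y s *m (plane_rotation x y s)^T = 1%:M.
  have -> : (plane_rotation x y s)^T = plane_rotation x y (- s).
    by apply/matrixP => i j; rewrite !mxE eq_sym cosN sinN; ring.
  by rewrite plane_rotationD subrr plane_rotation0.
split=> //; rewrite (splitr t) -plane_rotationD det_mulmx.
by rewrite -{2}det_tr -det_mulmx orth det1.
Qed.

Lemma circle_rotation s t :
  circle x y s *m plane_rotation x y t = circle x y (s + t).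
Proof.
rewrite mul_plane_rotation /circle !dot_linear xx yy (dotC y x) xy cosD sinD.
by apply/rowP => j; rewrite !mxE; ring.
Qed.

Lemma plane_rotation_fix t v :
  dot v x = 0 -> dot v y = 0 -> v *m plane_rotation x y t = v.
Proof. by move=> vx vy; rewrite mul_plane_rotation vx vy !scale0r !addr0. Qed.

End Orthonormal.
End PlaneRotation.

Section RelativeProjection.
Context {R : realType} {n : nat}.
Implicit Types (u v w : 'rV[R]_n) (p : {vspace 'rV[R]_n}).

(** The orthogonal projection onto the intersection of [p] with the orthogonal
    complement of [v]: inside [p], that intersection is the orthogonal complement
    of [oproj p v].  At a vertex [v] of a polygon it projects the tangent
    directions; for [v = 0] it is [oproj p], so that lengths and turning angles
    are averaged by the same statement. *)
Definition rproj p v u :=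
  oproj p u - (dot (oproj p u) v / dot (oproj p v) v) *: oproj p v.

Lemma rproj0 p u : rproj p 0 u = oproj p u.
Proof. by rewrite /rproj dot0r mul0r scale0r subr0. Qed.

Lemma rproj_linear p v k u w :
  rproj p v (k *: u + w) = k *: rproj p v u + rproj p v w.
Proof.
rewrite /rproj linearP/= !dot_linear.
by apply/rowP => j; rewrite !mxE; ring.
Qed.

HB.instance Definition _ p v := GRing.isLinear.Build R 'rV[R]_n 'rV[R]_n _
  (rproj p v) (rproj_linear p v).

Lemma rprojD p v u w : rproj p v (u + w) = rproj p v u + rproj p v w.
Proof. exact: linearD. Qed.

Lemma rprojZ p v k u : rproj p v (k *: u) = k *: rproj p v u.
Proof. exact: linearZ. Qed.

Lemma rprojN p v u : rproj p v (- u) = - rproj p v u.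
Proof. exact: linearN. Qed.

Lemma dot_oproj_eq0 p u : (dot (oproj p u) u == 0) = (oproj p u == 0).
Proof. by rewrite -dot_oproj dot_eq0. Qed.

(** This closed form also holds when [oproj p v = 0], and it is the reason why
    the angle between two projections is a measurable function of [p]. *)
Lemma dot_rproj p v u w : dot (rproj p v u) (rproj p v w) =
  dot (oproj p u) w
  - dot (oproj p u) v * dot (oproj p w) v / dot (oproj p v) v.
Proof.
rewrite /rproj !dot_linear !dot_oproj (oproj_sym p v w).
have [v0|v0] := eqVneq (dot (oproj p v) v) 0.
  by rewrite v0 invr0; ring.
by field.
Qed.

Lemma rproj_rotate (Q : 'M[R]_n) p v u : Q *m Q^T = 1%:M -> v *m Q = v ->
  rproj (linfun (mulmxr Q) @: p)%VS v (u *m Q) = rproj p v u *m Q.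
Proof.
move=> QQ vQ; have dotQ a b := dot_orthogonal a b QQ.
have dotv a : dot (a *m Q) v = dot a v by rewrite -{1}vQ dotQ.
have piv : oproj (linfun (mulmxr Q) @: p)%VS v = oproj p v *m Q.
  by rewrite -{1}vQ oproj_rotate.
by rewrite /rproj oproj_rotate// piv !dotv mulmxBl -scalemxAl.
Qed.

End RelativeProjection.

(** * Measurability on the Grassmannian *)

Section RealMeasurable.
Context d (T : measurableType d) (R : realType).
Implicit Types f : T -> R.

Lemma measurable_fun_powR (r : R) f :
  measurable_fun setT f -> measurable_fun setT (fun x => f x `^ r).
Proof. by move=> mf; exact: (measurableT_comp (measurable_powR r) mf). Qed.

Lemma measurable_fun_inv f : (forall x, 0 <= f x) ->
  measurable_fun setT f -> measurable_fun setT (fun x => (f x)^-1).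
Proof.
move=> f0 mf; under eq_fun do rewrite -powR_inv1//.
exact: measurable_fun_powR.
Qed.

Lemma measurable_fun_sqrt f : (forall x, 0 <= f x) ->
  measurable_fun setT f -> measurable_fun setT (fun x => Num.sqrt (f x)).
Proof.
move=> f0 mf; under eq_fun do rewrite -powR12_sqrt//.
exact: measurable_fun_powR.
Qed.

Lemma measurable_fun_acos f : (forall x, -1 <= f x <= 1) ->
  measurable_fun setT f -> measurable_fun setT (fun x => acos (f x)).
Proof.
move=> f1 mf.
(* acos is monotone only between -1 and 1, hence the truncation *)
pose g (x : R) := acos (Num.min 1 (Num.max (-1) x)).
have clip (x : R) : -1 <= Num.min 1 (Num.max (-1) x) <= 1.
  by rewrite le_min ge_min le_max lexx/=; lra.
rewrite (_ : (fun x => _) = g \o f); last first.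
  apply/funext => x /=; rewrite /g; have /andP[a b] := f1 x.
  by rewrite (max_idPr a) (min_idPr b).
apply: (measurableT_comp _ mf); apply: nonincreasing_measurable => // x y xy.
rewrite /g leNgt -ltr_cos ?in_itv/= ?acos_ge0 ?acos_lepi//.
rewrite !acosK ?in_itv//= -leNgt.
have maxxy : Num.max (-1) x <= Num.max (-1) y.
  by rewrite ge_max !le_max lexx xy orbT.
by rewrite le_min !ge_min lexx maxxy orbT.
Qed.

End RealMeasurable.

Section RandomSubspace.
Context {R : realType} {n k : nat} {kn : (k <= n)%N}.
Local Notation G := (grassmannian R kn).
Implicit Types (u v w x y : 'rV[R]_n) (p : G).

Lemma continuous_grassmannian_measurable (f : G -> R) :
  continuous f -> measurable_fun setT f.
Proof.
move=> /continuousP cf; apply: (measurability _ (RGenOInfty.measurableE R)).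
move=> _ [_ [r ->] <-]; rewrite setTI; apply: sub_sigma_algebra.
exact/cf/rray_open.
Qed.

Lemma dot_oproj_mx p u w :
  dot (oproj (val p) u) w = \sum_i \sum_j u 0 i * oproj_mx p i j * w 0 j.
Proof.
have -> : oproj (val p) u = u *m oproj_mx p.
  by rewrite /oproj_mx mul_rV_lin1.
rewrite dotE exchange_big/=; apply: eq_bigr => j _.
by rewrite mxE mulr_suml.
Qed.

Lemma measurable_dot_oproj u w :
  measurable_fun setT (fun p : G => dot (oproj (val p) u) w).
Proof.
under eq_fun do rewrite dot_oproj_mx.
apply: measurable_sum => i; apply: measurable_sum => j.
apply: measurable_funM => //; apply: measurable_funM => //.
apply: continuous_grassmannian_measurable => p.
apply: (@continuous_comp G 'M[R]_n R (@oproj_mx R n k kn) (fun M => M i j)).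
  exact: initial_continuous.
exact: coord_continuous.
Qed.

Lemma measurable_dot_rproj v u w :
  measurable_fun setT (fun p : G => dot (rproj (val p) v u) (rproj (val p) v w)).
Proof.
under eq_fun do rewrite dot_rproj.
apply: measurable_funB; first exact: measurable_dot_oproj.
apply: measurable_funM.
  by apply: measurable_funM; exact: measurable_dot_oproj.
apply: measurable_fun_inv; last exact: measurable_dot_oproj.
by move=> p; rewrite -dot_oproj dot_ge0.
Qed.

Lemma measurable_angle_rproj v u w :
  measurable_fun setT (fun p : G => angle (rproj (val p) v u) (rproj (val p) v w)).
Proof.
apply: measurable_fun_acos => [p|].
  suff <- : dot (normalize (rproj (val p) v u)) (normalize (rproj (val p) v w)) =
      dot (rproj (val p) v u) (rproj (val p) v w) /
      (enorm (rproj (val p) v u) * enorm (rproj (val p) v w)).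
    exact: dot_normalize_itv.
  by rewrite dotZl dotZr invfM; ring.
apply: measurable_funM; first exact: measurable_dot_rproj.
apply: measurable_fun_inv => [p|]; first by rewrite mulr_ge0 ?sqrtr_ge0.
apply: measurable_funM; apply: measurable_fun_sqrt => [p|];
  by [rewrite dot_ge0|exact: measurable_dot_rproj].
Qed.

Lemma measurable_rproj_eq0 v u :
  measurable [set p : G | rproj (val p) v u = 0].
Proof.
rewrite [X in measurable X](_ : _ = setT `&`
    (fun p : G => dot (rproj (val p) v u) (rproj (val p) v u)) @^-1` [set 0]).
  exact: (measurable_dot_rproj v u u measurableT (measurable_set1 0)).
by rewrite setTI; apply/seteqP; split => p /= /eqP; rewrite ?dot_eq0 => /eqP//->;
  rewrite dot0l.
Qed.

Lemma rproj_self (p : {vspace 'rV[R]_n}) v : rproj p v v = 0.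
Proof.
rewrite /rproj; have [/eqP|v0] := eqVneq (dot (oproj p v) v) 0.
  by rewrite dot_oproj_eq0 => /eqP->; rewrite scaler0 subr0.
by rewrite divff// scale1r subrr.
Qed.

(** If all of [p] projected to [0], then [p] would lie on the line spanned by
    [oproj p v]. *)
Lemma rproj_neq0_exists (p : {vspace 'rV[R]_n}) v : (1 < \dim p)%N ->
  exists i, rproj p v (delta_mx 0 i) != 0.
Proof.
move=> p2; apply/not_existsP => all0; suff : (\dim p <= 1)%N by rewrite leqNgt p2.
apply: leq_trans (_ : \dim <[oproj p v]> <= 1)%N; last by rewrite dim_vline leq_b1.
apply/dimvS/subvP => u pu; suff : rproj p v u = 0.
  by move/eqP; rewrite subr_eq0 oproj_id// => /eqP->; rewrite memvZ// memv_line.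
rewrite (row_sum_delta u) linear_sum big1// => i _.
by rewrite linearZ/=; have /negP := all0 i; rewrite negbK => /eqP->; rewrite scaler0.
Qed.

End RandomSubspace.

Section RotationInvariance.
Context {R : realType} {n k : nat} {kn : (k <= n)%N}.
Local Notation G := (grassmannian R kn).
Variable mu : probability G R.
Hypothesis mu_rot : rotation_invariant mu.
Implicit Types (u v w x y : 'rV[R]_n) (p : G).

Lemma measure_rproj_eq0_rotate (Q : 'M[R]_n) v x : rotation_mx Q -> v *m Q = v ->
  mu [set p | rproj (val p) v (x *m Q) = 0] = mu [set p | rproj (val p) v x = 0].
Proof.
move=> rQ vQ; rewrite -(mu_rot rQ (measurable_rproj_eq0 _ _)).
congr (mu _); apply/seteqP; split => p /=; rewrite val_rotate// rproj_rotate ?rQ.1//.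
  move=> p0; have := congr1 (mulmxr Q^T) p0; rewrite /= mul0mx -mulmxA rQ.1.
  by rewrite mulmx1.
by move=> ->; rewrite mul0mx.
Qed.

End RotationInvariance.

(** * Rotation invariance and null sets of planes *)

Section EqualDistribution.
Local Open Scope ereal_scope.
Context d (T : measurableType d) (R : realType).
Variable mu : {measure set T -> \bar R}.

(** A nonnegative function is integrated through its distribution.  So a
    transformation that preserves the measure preserves the integral of [f] as
    soon as [f] and its transform are measurable, whether or not the
    transformation is known to be. *)
Lemma ge0_integral_eq_distribution (f g : T -> R) :
  measurable_fun setT f -> measurable_fun setT g ->
  (forall x, 0 <= f x)%R -> (forall x, 0 <= g x)%R ->
  (forall A, measurable A -> mu (f @^-1` A) = mu (g @^-1` A)) ->
  \int[mu]_x (f x)%:E = \int[mu]_x (g x)%:E.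
Proof.
move=> mf mg f0 g0 fg.
have norm_push (h : T -> R) : measurable_fun setT h -> (forall x, 0 <= h x)%R ->
    \int[mu]_x (h x)%:E = \int[pushforward mu h]_y `|y|%:E.
  move=> mh h0; rewrite [RHS](ge0_integral_pushforward mh)//.
    by rewrite preimage_setT; apply: eq_integral => x _ /=; rewrite ger0_norm.
  by apply/measurable_EFinP; exact: normr_measurable.
rewrite (norm_push f)// (norm_push g)//.
by apply: eq_measure_integral => A mA _; exact: fg.
Qed.

(** Nothing is known about the measurability of the length of the projected curve
    on the null set of degenerate planes, so [f] is arbitrary there.  The integral
    of a nonnegative function is a supremum over simple functions below it, hence
    monotone without measurability, and [f] is squeezed between measurable
    functions that are [0] and [+oo] on the null set. *)
Lemma ge0_integral_ae_eq (f g : T -> \bar R) :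
  (forall x, 0 <= f x) -> (forall x, 0 <= g x) -> measurable_fun setT g ->
  (\forall x \ae mu, f x = g x) -> \int[mu]_x f x = \int[mu]_x g x.
Proof.
move=> f0 g0 mg [N [mN N0 fgN]].
have fg x : ~ N x -> f x = g x by move=> Nx; apply: contrapT => /fgN.
have le_int (h1 h2 : T -> \bar R) : (forall x, 0 <= h1 x) ->
    (forall x, h1 x <= h2 x) -> \int[mu]_x h1 x <= \int[mu]_x h2 x.
  move=> h10 h12; have h20 x : 0 <= h2 x by exact: le_trans (h12 x).
  rewrite !ge0_integralTE//; apply: ereal_sup_le => _ [h hh1 <-].
  by exists h => // x; apply: le_trans (h12 x).
pose g' x := if x \in N then +oo else g x.
have mg' : measurable_fun setT g'.
  by apply: measurable_fun_ifT => //; apply: (measurable_fun_bool true);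
    rewrite setTI (_ : _ @^-1` _ = N)//; apply/seteqP; split => x /=;
    [move/set_mem|move/mem_set].
have g'0 x : 0 <= g' x by rewrite /g'; case: ifP.
have intg h : (forall x, 0 <= h x) -> measurable_fun setT h ->
    \int[mu]_x h x = \int[mu]_(x in ~` N) h x.
  by move=> h0 mh; rewrite (ge0_negligible_integral mN)// setTD.
apply/eqP; rewrite eq_le; apply/andP; split.
  apply: (@le_trans _ _ (\int[mu]_x g' x)).
    apply: le_int => // x; rewrite /g'; case: ifPn => [_|/negP]; first exact: leey.
    by rewrite inE => /fg->.
  rewrite intg// [leRHS]intg// le_eqVlt; apply/orP; left; apply/eqP.
  apply: eq_integral => x; rewrite inE /g' => Nx.
  by rewrite memNset.
rewrite intg// integral_mkcond; apply: le_int => x.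
  by apply: erestrict_ge0 => y _; exact: g0.
by rewrite patchE; case: ifPn => // /set_mem/fg->.
Qed.

End EqualDistribution.

Section RotationInvariance.
Context {R : realType} {n k : nat} {kn : (k <= n)%N}.
Local Notation G := (grassmannian R kn).
Variable mu : probability G R.
Hypothesis mu_rot : rotation_invariant mu.
Implicit Types (u v w x y : 'rV[R]_n) (p : G).

Lemma angle_orthogonal (Q : 'M[R]_n) u w : Q *m Q^T = 1%:M ->
  angle (u *m Q) (w *m Q) = angle u w.
Proof.
by move=> QQ; rewrite /angle /enorm !dot_orthogonal.
Qed.

Lemma integral_angle_rotate (Q : 'M[R]_n) v u w : rotation_mx Q -> v *m Q = v ->
  (\int[mu]_p (angle (rproj (val p) v (u *m Q)) (rproj (val p) v (w *m Q)))%:E =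
   \int[mu]_p (angle (rproj (val p) v u) (rproj (val p) v w))%:E)%E.
Proof.
move=> rQ vQ.
pose f a b p := angle (rproj (val p) v a) (rproj (val p) v b).
have mf a b : measurable_fun setT (f a b) by exact: measurable_angle_rproj.
apply: (@ge0_integral_eq_distribution _ _ _ mu (f (u *m Q) (w *m Q)) (f u w)).
- exact: mf.
- exact: mf.
- by move=> p; exact: angle_ge0.
- by move=> p; exact: angle_ge0.
move=> A mA; have mfA : measurable (f (u *m Q) (w *m Q) @^-1` A).
  by rewrite -[X in measurable X]setTI; exact: mf.
apply: etrans (esym (mu_rot rQ mfA)) _; congr (mu _).
apply/seteqP; split => p; rewrite /f /preimage /mkset (val_rotate _ rQ).
  by rewrite !(rproj_rotate _ _ rQ.1 vQ) (angle_orthogonal _ _ rQ.1).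
by rewrite !(rproj_rotate _ _ rQ.1 vQ) (angle_orthogonal _ _ rQ.1).
Qed.

Section NullSets.
Variable v : 'rV[R]_n.
Local Notation Z u := [set p : G | rproj (val p) v u = 0].

(** The vectors [x + i y], [i] a natural number, are positive multiples of rotated
    copies of [x], so all the sets of planes where one of them projects to [0] have
    the same measure.  Two such vectors span [x] and [y], so these sets are
    disjoint off the set [B] where [x] and [y] both project to [0].  In a
    probability space infinitely many disjoint sets of equal measure are null. *)
Lemma rproj_eq0_ae_perp x y : dot x x = 1 -> dot y y = 1 -> dot x y = 0 ->
  dot v x = 0 -> dot v y = 0 ->
  \forall p \ae mu, rproj (val p) v x = 0 -> rproj (val p) v y = 0.
Proof.
move=> xx yy xy vx vy.
have mZ u : measurable (Z u) by exact: measurable_rproj_eq0.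
pose w (i : nat) := x + i%:R *: y.
pose B := Z x `&` Z y; have mB : measurable B by exact: measurableI.
pose F i := Z (w i) `\` B; have mF i : measurable (F i) by exact: measurableD.
have wE i : w i = (cos (atan i%:R))^-1 *: circle x y (atan i%:R).
  have c0 : cos (atan i%:R) != 0 :> R by rewrite gt_eqF// cos_atan_gt0.
  by rewrite /circle sin_atan scalerDr !scalerA mulrCA mulVf// scale1r mulr1.
have ZwE i : Z (w i) = Z (circle x y (atan i%:R)).
  have c0 : (cos (atan i%:R))^-1 != 0 :> R.
    by rewrite invr_eq0 gt_eqF// cos_atan_gt0.
  apply/seteqP; split => p /=; rewrite wE linearZ/=.
    by move/eqP; rewrite scaler_eq0 (negbTE c0) => /eqP.
  by move->; rewrite scaler0.
have muZ i : mu (Z (w i)) = mu (Z x).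
  rewrite ZwE -(add0r (atan _)) -(circle_rotation xx yy xy) circle0.
  apply: measure_rproj_eq0_rotate => //; first exact: plane_rotation_rotation.
  exact: plane_rotation_fix.
have BZ i : B `<=` Z (w i).
  by move=> p [/= px py]; rewrite linearD linearZ/= px py scaler0 addr0.
have muD A : measurable A -> B `<=` A -> (mu (A `\` B) = mu A - mu B)%E.
  move=> mA BA; rewrite measureD// ?(setIidr BA)//.
  by rewrite (le_lt_trans (probability_le1 _ _)) ?ltry.
have muF i : mu (F i) = mu (Z x `\` B).
  by rewrite (muD _ (mZ _) (BZ i)) (muD _ (mZ _) (@subIsetl _ _ _)) muZ.
have tF : trivIset setT F.
  apply/trivIsetP => i j _ _ ij; apply/seteqP; split => // p [[/= pi pB] [/= pj _]].
  apply: pB; have py : rproj (val p) v y = 0.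
    have : rproj (val p) v (w i - w j) = 0 by rewrite linearB/= pi pj subrr.
    rewrite /w opprD addrACA subrr add0r -scalerBl linearZ/= => /eqP.
    by rewrite scaler_eq0 subr_eq0 eqr_nat (negbTE ij) => /eqP.
  by split => //=; move: pi; rewrite linearD linearZ/= py scaler0 addr0.
have null : mu (Z x `\` B) = 0%E.
  apply/eqP; rewrite eq_le measure_ge0 andbT.
  apply/lee_addgt0Pr => e e0; rewrite add0e.
  pose m := Num.bound e^-1.
  have me : (e^-1 < m%:R)%R by rewrite archi_boundP// invr_ge0 ltW.
  have : (\sum_(i < m) mu (F i) <= 1)%E.
    have <- : mu (\big[setU/set0]_(i < m) F i) = (\sum_(i < m) mu (F i))%E.
      exact: measure_bigsetU.
    by apply: probability_le1; exact: bigsetU_measurable.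
  under eq_bigr do rewrite muF.
  have /fineK <- : mu (Z x `\` B) \is a fin_num.
    by rewrite fin_num_measure//; exact: measurableD.
  rewrite sumEFin !lee_fin sumr_const card_ord -mulr_natr => le1.
  have m0 : (0 < m%:R :> R)%R by rewrite (le_lt_trans _ me)// invr_ge0 ltW.
  rewrite -ler_pdivlMr// div1r in le1; rewrite (le_trans le1)//.
  by rewrite invf_ple// ltW.
exists (Z x `\` B); split=> //; first exact: measurableD.
move=> p /= /not_implyP[px py]; split=> // -[].
by move=> _ /py.
Qed.

End NullSets.
End RotationInvariance.

(** * The mean angle between projections *)

Section AdditiveFunction.
Context {R : realType}.

(** The reflection gives [f (pi / 2) = pi / 2], then additivity [f d = d] for
    [d = pi / (2 m)].  A nonnegative additive function is monotone, so that [f s]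
    is at least any multiple of [d] below [s], hence [s <= f s].  The opposite
    inequality is this one at [pi - s]. *)
Lemma additive_reflection_id (f : R -> R) :
  (forall s, 0 <= s <= pi -> 0 <= f s) ->
  (forall s t, 0 <= s -> 0 <= t -> s + t < pi -> f (s + t) = f s + f t) ->
  (forall s, 0 <= s <= pi -> f s + f (pi - s) = pi) ->
  forall s, 0 <= s <= pi -> f s = s.
Proof.
move=> f0 fD fC; have pi0 := pi_gt0 R.
have f00 : f 0 = 0 by have := fD 0 0; rewrite addr0 lexx => /(_ isT isT pi0); lra.
have fpi : f pi = pi.
  by have := fC 0; rewrite lexx ltW//= subr0 f00 add0r => ->.
have fhalf : f (pi / 2) = pi / 2.
  by have := fC (pi / 2); rewrite (_ : pi - pi / 2 = pi / 2); [lra|field].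
have fMn (d : R) m : 0 <= d -> d *+ m < pi -> f (d *+ m) = f d *+ m.
  move=> d0; elim: m => [|m IH] lt; first by rewrite !mulr0n.
  rewrite !mulrS fD ?mulrn_wge0//; last by rewrite -mulrS.
  by rewrite IH// (le_lt_trans _ lt)// mulrS lerDr.
have ge s : 0 <= s < pi -> s <= f s.
  move=> /andP[s0 spi]; apply/ler_addgt0Pr => e e0.
  have [m m0 me] : exists2 m : nat, 0 < m%:R :> R & pi / 2 / e < m%:R.
    exists (Num.bound (pi / 2 / e)).+1; rewrite ?ltr0n// (lt_trans (archi_boundP _))//.
      by rewrite ltW// !divr_gt0.
    by rewrite ltr_nat.
  pose d : R := pi / 2 / m%:R; have d0 : 0 < d by rewrite !divr_gt0.
  have de : d < e by rewrite /d ltr_pdivrMr// [ltRHS]mulrC -ltr_pdivrMr.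
  have dm : d *+ m = pi / 2 by rewrite -[d *+ m]mulr_natr /d divfK// gt_eqF.
  have fd : f d = d.
    have : f (d *+ m) = f d *+ m by apply: fMn; rewrite ?ltW// dm; lra.
    rewrite dm fhalf -{1}dm -[d *+ m]mulr_natr -[f d *+ m]mulr_natr.
    by move=> E; apply/esym/(@mulIf _ m%:R _ _ _ E); rewrite gt_eqF.
  have [k ks sk] : exists2 k, d *+ k <= s & s < d *+ k.+1.
    have sd0 : 0 <= s / d by rewrite divr_ge0// ltW.
    exists (Num.truncn (s / d)).
      by rewrite -[d *+ _]mulr_natl -ler_pdivlMr// truncn_le.
    by rewrite -[d *+ _]mulr_natl -ltr_pdivrMr// truncnS_gt.
  have kpi : d *+ k < pi by exact: le_lt_trans spi.
  have fk : f (d *+ k) = d *+ k by rewrite fMn ?ltW// fd.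
  have -> : f s = d *+ k + f (s - d *+ k).
    have sE : s = d *+ k + (s - d *+ k) by rewrite addrC subrK.
    have E : f (d *+ k + (s - d *+ k)) = f (d *+ k) + f (s - d *+ k).
      by apply: fD; rewrite ?subr_ge0 -?sE// mulrn_wge0// ltW.
    by rewrite -sE fk in E.
  have : 0 <= f (s - d *+ k).
    apply: f0; rewrite subr_ge0 ks/= lerBlDr (le_trans (ltW spi))// lerDl.
    by rewrite mulrn_wge0// ltW.
  by move: sk; rewrite mulrSr; lra.
move=> s /andP[s0]; rewrite le_eqVlt => /predU1P[->//|spi].
move: s0; rewrite le_eqVlt => /predU1P[<-//|s0].
have h1 : s <= f s by apply: ge; rewrite ltW.
have h2 : pi - s <= f (pi - s) by apply: ge; lra.
by have := fC s; rewrite ltW//= ltW// => /(_ isT); lra.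
Qed.

(** [M s t] stands for the mean angle between the projections of the points [s]
    and [t] of a great circle, where [t + pi] is antipodal to [t]. *)
Lemma stationary_additive_id (M : R -> R -> \bar R) :
  (forall s t, 0 <= M s t)%E -> (forall s t, M s t = M t s) ->
  (forall s, M s s = 0%E) -> (forall s t r, M (s + r) (t + r) = M s t) ->
  (forall s t r, s <= t -> t <= r -> 0 < r - s < pi ->
     M s r = (M s t + M t r)%E) ->
  (forall s t, M s t + M s (t + pi)%R = pi%:E)%E ->
  forall t, 0 <= t <= pi -> M 0 t = t%:E.
Proof.
move=> M0 MC Mid shift MD Mpi t t0pi.
have Mfin s : M 0 s \is a fin_num.
  by rewrite ge0_fin_numE// (le_lt_trans _ (ltry pi))// -(Mpi 0 s) leeDl.
have M0E s r : M s (s + r) = M 0 r by rewrite -(shift 0 r s) add0r addrC.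
have FD s r : 0 <= s -> 0 <= r -> s + r < pi -> M 0 (s + r) = (M 0%R s + M 0%R r)%E.
  move=> s0 r0 sr; have [sr0|sr0] := eqVneq (s + r) 0.
    move/eqP: sr0; rewrite paddr_eq0// => /andP[/eqP-> /eqP->].
    by rewrite addr0 Mid adde0.
  rewrite -(M0E s r); apply: (MD 0 s (s + r)) => //; first by rewrite lerDl.
  by rewrite subr0 sr andbT lt_neqAle eq_sym sr0 addr_ge0.
have FC s : (M 0%R s + M 0%R (pi - s)%R = pi%:E)%E.
  by rewrite -(M0E s (pi - s)) (addrC s) subrK (MC 0 s) -(Mpi s 0) add0r.
rewrite -[LHS](fineK (Mfin t)); congr EFin.
apply: (additive_reflection_id (f := fun s => fine (M 0 s))) t0pi.
- by move=> s _; exact: fine_ge0.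
- by move=> s r s0 r0 sr; rewrite FD// fineD.
- by move=> s _; rewrite -fineD// FC.
Qed.

End AdditiveFunction.

Section MeanAngle.
Context {R : realType} {n k : nat} {kn : (k <= n)%N}.
Local Notation G := (grassmannian R kn).
Variable mu : probability G R.
Hypotheses (mu_rot : rotation_invariant mu) (k2 : (1 < k)%N).
Implicit Types (u v w x y : 'rV[R]_n) (p : G).

(** Almost surely, if [x] projects to [0], then so does every vector orthogonal to
    [x] and [v], hence every vector, and [p] would be at most a line. *)
Lemma rproj_ae_neq0 v x : x != 0 -> dot v x = 0 ->
  \forall p \ae mu, rproj (val p) v x != 0.
Proof.
move=> x0 vx; pose x' := normalize x.
have xx : dot x' x' = 1 by rewrite /x' dot_normalize x0.
have vx' : dot v x' = 0 by rewrite /x' dotZr vx mulr0.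
have ix0 : (enorm x)^-1 != 0 by rewrite invr_eq0 gt_eqF// enorm_gt0.
have x'E : x' = (enorm x)^-1 *: x by [].
clearbody x'.
have : \forall p \ae mu, forall i,
    rproj (val p) v x' = 0 -> rproj (val p) v (delta_mx 0 i) = 0.
  apply: filter_forall => i; set e : 'rV[R]_n := delta_mx 0 i.
  pose w := e - (dot e v / dot v v) *: v - dot e x' *: x'.
  have vw : dot v w = 0.
    have [->|v0] := eqVneq v 0; first by rewrite dot0l.
    rewrite /w !dot_linear vx' mulr0 oppr0 addr0 divfK ?dot_eq0//.
    by rewrite dotC subrr.
  have xw : dot x' w = 0.
    rewrite /w !dot_linear xx mulr1 (dotC x' v) vx' mulr0 oppr0 addr0.
    by rewrite dotC subrr.
  have eE p : rproj (val p) v x' = 0 -> rproj (val p) v e = rproj (val p) v w.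
    by move=> px; rewrite /w !rprojD !rprojN !rprojZ px rproj_self !scaler0 !subr0.
  have [w0|w0] := eqVneq w 0.
    by apply: filterE => p px; rewrite eE// w0 linear0.
  pose y := normalize w.
  apply: filterS (@rproj_eq0_ae_perp R n k kn mu mu_rot v x' y _ _ _ _ _) => //.
  - move=> p /= H px; rewrite eE//; move: (H px); rewrite /y rprojZ => /eqP.
    by rewrite scaler_eq0 invr_eq0 gt_eqF ?enorm_gt0//= => /eqP.
  - by rewrite /y dot_normalize w0.
  - by rewrite /y dotZr xw mulr0.
  - by rewrite /y dotZr vw mulr0.
apply: filterS => p H; apply/eqP => px.
have [|i /eqP[]] := @rproj_neq0_exists R n (val p) v; first by rewrite (eqP (valP p)).
by apply: H; rewrite x'E rprojZ px scaler0.
Qed.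

Local Notation mean v a b :=
  (\int[mu]_p (angle (rproj (val p) v a) (rproj (val p) v b))%:E)%E.

Lemma measurable_angle_rprojE v a b : measurable_fun setT
  (fun p : G => (angle (rproj (val p) v a) (rproj (val p) v b))%:E).
Proof. by apply/measurable_EFinP; exact: measurable_angle_rproj. Qed.

Lemma mean_angle_self v a : a != 0 -> dot v a = 0 -> mean v a a = 0%E.
Proof.
move=> a0 va; rewrite -[RHS](integral0 mu setT); apply: ge0_integral_ae_eq => //.
  by move=> p; rewrite lee_fin angle_ge0.
by apply: filterS (rproj_ae_neq0 a0 va) => p p0; rewrite angle_self.
Qed.

Lemma mean_angleN v a b : (mean v a b + mean v a (- b) = pi%:E)%E.
Proof.
rewrite -ge0_integralD//; try exact: measurable_angle_rprojE;
  try by move=> p _; rewrite lee_fin angle_ge0.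
transitivity (\int[mu]_p (cst pi%:E p))%E.
  by apply: eq_integral => p _; rewrite -EFinD rprojN angleNr addrC subrK.
by rewrite integral_cst// -[RHS]mule1; congr (_ * _)%E; exact: probability_setT.
Qed.

Section Circle.
Variables v x y : 'rV[R]_n.
Hypotheses (xx : dot x x = 1) (yy : dot y y = 1) (xy : dot x y = 0).
Hypotheses (vx : dot v x = 0) (vy : dot v y = 0).
Local Notation c := (circle x y).

Lemma circle_neq0 t : c t != 0.
Proof. by rewrite -dot_eq0 circle_unit// oner_eq0. Qed.

Lemma dot_circle0 t : dot v (c t) = 0.
Proof. by rewrite /circle !dot_linear vx vy !mulr0 addr0. Qed.

Lemma mean_angle_shift s t r : mean v (c (s + r)) (c (t + r)) = mean v (c s) (c t).
Proof.
rewrite -(circle_rotation xx yy xy s r) -(circle_rotation xx yy xy t r).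
apply: integral_angle_rotate => //.
  exact: plane_rotation_rotation.
exact: plane_rotation_fix.
Qed.

Lemma mean_angle_add (s t r : R) : s <= t -> t <= r -> 0 < r - s < pi ->
  (mean v (c s) (c r) = mean v (c s) (c t) + mean v (c t) (c r))%E.
Proof.
move=> st tr sr.
rewrite -ge0_integralD//; try exact: measurable_angle_rprojE;
  try by move=> p _; rewrite lee_fin angle_ge0.
apply: ge0_integral_ae_eq.
- by move=> p; rewrite lee_fin angle_ge0.
- by move=> p; rewrite -EFinD lee_fin addr_ge0 ?angle_ge0.
- by apply: emeasurable_funD; exact: measurable_angle_rprojE.
have ae0 q := rproj_ae_neq0 (circle_neq0 q) (dot_circle0 q).
apply: filterS (filterI (filterI (ae0 s) (ae0 t)) (ae0 r)) => p [[/= ps pt] pr].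
rewrite -EFinD; congr EFin.
have cE q : rproj (val p) v (c q) =
    circle (rproj (val p) v x) (rproj (val p) v y) q.
  by rewrite /circle rprojD !rprojZ.
rewrite !cE in ps pt pr *; apply: angle_circle_add => //.
by case/andP: sr.
Qed.

Lemma mean_angle_circle t : 0 <= t <= pi -> mean v (c 0) (c t) = t%:E.
Proof.
apply: (@stationary_additive_id _ (fun s t => mean v (c s) (c t))).
- by move=> s r; apply: integral_ge0 => p _; rewrite lee_fin angle_ge0.
- by move=> s r; apply: eq_integral => p _; rewrite (angleC (rproj (val p) v (c s))).
- by move=> s; apply: mean_angle_self; [exact: circle_neq0|exact: dot_circle0].
- exact: mean_angle_shift.
- exact: mean_angle_add.
move=> s r; have -> : c (r + pi) = - c r; last exact: mean_angleN.
by rewrite /circle sinDpi cosDpi !scaleNr opprD.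
Qed.

End Circle.

(** The Crofton formula that underlies both identities: the great circle through
    [a] and [b] is invariant under the rotations of its plane, which fix [v], and
    its projections to almost all planes have additive angles. *)
Theorem mean_angle_rproj v a b : dot a a = 1 -> dot b b = 1 ->
  dot v a = 0 -> dot v b = 0 -> mean v a b = (angle a b)%:E.
Proof.
move=> aa bb va vb; pose w := b - dot a b *: a.
have aw : dot a w = 0 by rewrite /w !dot_linear aa mulr1 subrr.
have a0 : a != 0 by rewrite -dot_eq0 aa oner_eq0.
have na : normalize a = a by exact: normalize_id.
have nb : normalize b = b by exact: normalize_id.
have ab1 : -1 <= dot a b <= 1 by have := dot_normalize_itv a b; rewrite na nb.
have angE : angle a b = acos (dot a b) by rewrite angleE na nb.
have [w0|w0] := eqVneq w 0.
  have bE : b = dot a b *: a by apply/eqP; rewrite -subr_eq0 -/w w0.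
  have : dot a b ^+ 2 = 1 by rewrite -[RHS]bb {2}bE dotZl expr2.
  move/eqP; rewrite sqrf_eq1 => /orP[] /eqP e; rewrite bE e.
    by rewrite scale1r angle_self// mean_angle_self.
  rewrite scaleN1r angleNr angle_self// subr0.
  apply: etrans (esym (add0e _)) _; apply: etrans (mean_angleN v a a).
  by congr (_ + _)%E; exact/esym/mean_angle_self.
pose y := normalize w.
have yy : dot y y = 1 by rewrite /y dot_normalize w0.
have ay : dot a y = 0 by rewrite /y dotZr aw mulr0.
have vy : dot v y = 0 by rewrite /y dotZr /w !dot_linear va vb mulr0 subr0 mulr0.
have wE : w = enorm w *: y by rewrite /y scalerA divff ?scale1r// gt_eqF// enorm_gt0.
have ww : dot w w = 1 - dot a b ^+ 2.
  by rewrite /w !dot_linear aa bb (dotC b a); ring.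
have bE : b = circle a y (angle a b).
  rewrite /circle angE acosK ?in_itv// sin_acos// -ww -/(enorm w) -wE /w.
  by rewrite addrC subrK.
rewrite {1}bE -{1}(circle0 a y) mean_angle_circle// angle_ge0.
exact: angle_lepi.
Qed.

End MeanAngle.

(** * Length of a curve with additive angles *)

Section Chains.
Context {R : realType}.
Implicit Types (a b d s t : R) (ts : seq R) (P Q : R -> R -> Prop).

(** The recursive form of a condition on all the intervals of a partition suits
    inductions on the partition. *)
Fixpoint chain P a ts : Prop :=
  if ts is d :: ts' then P a d /\ chain P d ts' else True.

Lemma chain_cat P a ts ts' :
  chain P a ts -> chain P (last a ts) ts' -> chain P a (ts ++ ts').
Proof. by elim: ts a => //= d ts IH a [ad dts] /(IH _ dts). Qed.

Lemma chain_nthP P b a ts : chain P a ts <->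
  forall i, (i < size ts)%N -> P (nth b (a :: ts) i) (nth b (a :: ts) i.+1).
Proof.
elim: ts a => [|d ts IH] a //=; split.
  by move=> [ad /IH dts] [|i] //; exact: dts.
by move=> H; split; [exact: (H 0%N)|apply/IH => i; exact: (H i.+1)].
Qed.

Lemma itv_partition_chain a b ts : itv_partition a b ts -> chain (fun s t => s < t) a ts.
Proof.
by move=> [+ _]; elim: ts a => //= d ts IH a /andP[ad /IH].
Qed.

End Chains.

Section Length.
Context {R : realType} {n : nat}.
Implicit Types (c : R -> 'rV[R]_n) (a b s t : R) (ts : seq R).

Definition angle_additive_on c a b := forall s t r, a <= s -> s <= t -> t <= r ->
  r <= b -> angle (c s) (c r) = angle (c s) (c t) + angle (c t) (c r).

(** [L] is the length from [a], measured along the partition [ts].  Inside an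
    interval the angle is the increment of [L] by additivity, and the triangle
    inequality at the points of [ts] extends the bound across intervals.  It
    telescopes along any other partition, which is thus never longer. *)
Lemma cumulative_length c a b ts : itv_partition a b ts ->
  chain (angle_additive_on c) a ts ->
  exists L : R -> R,
    L b - L a = \sum_(0 <= i < size ts)
      angle (c (nth b (a :: ts) i)) (c (nth b (a :: ts) i.+1)) /\
    forall s t, a <= s -> s < t -> t <= b -> angle (c s) (c t) <= L t - L s.
Proof.
elim: ts a => [|d ts IH] a.
  move=> /itv_partition_nil -> _; exists (cst 0).
  by rewrite big_nil subrr; split=> // s t sb /lt_le_trans lt /lt; rewrite ltNge sb.
move=> abd [add dts]; have db := itv_partition_cons abd.
have ad : a < d by case: abd => /= /andP[].
have ledb := itv_partition_le db.
have [L [Lb Ladd]] := IH d db dts.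
have aa : angle (c a) (c a) = 0.
  by have := add a a a (lexx _) (lexx _) (lexx _) (ltW ad); lra.
pose L' t := if t <= d then angle (c a) (c t) else angle (c a) (c d) + (L t - L d).
have L'd t : d <= t -> L' t = angle (c a) (c d) + (L t - L d).
  rewrite le_eqVlt => /predU1P[<-|dt]; first by rewrite /L' lexx; lra.
  by rewrite /L' leNgt dt.
exists L'; split.
  rewrite L'd// /L' (ltW ad) aa subr0 /= big_nat_recl//=.
  by congr (_ + _); rewrite Lb.
move=> s t sa st tb; have [td|dt] := leP t d.
  rewrite /L' td (le_trans (ltW st) td).
  by rewrite (add a s t (lexx _) sa (ltW st) td) addrAC subrr add0r.
rewrite (L'd t (ltW dt)); have [ds|sd] := leP d s.
  by rewrite (L'd s ds); have := Ladd s t ds st tb; lra.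
rewrite /L' (ltW sd); have := angle_triangle (c s) (c d) (c t).
have := Ladd d t (lexx _) dt tb; have := add a s d (lexx _) sa (ltW sd) (lexx _).
by lra.
Qed.

Lemma curve_length_chain c a b ts : itv_partition a b ts ->
  chain (angle_additive_on c) a ts ->
  curve_length a b c = (\sum_(0 <= i < size ts)
    angle (c (nth b (a :: ts) i)) (c (nth b (a :: ts) i.+1)))%:E.
Proof.
move=> abts add; apply/eqP; rewrite eq_le; apply/andP; split; last first.
  by apply: ereal_sup_ubound; exists ts.
have [L [<- Ladd]] := cumulative_length abts add.
apply: ub_ereal_sup => _ [D abD <-]; rewrite lee_fin.
suff sum_le a' : a <= a' -> itv_partition a' b D ->
    \sum_(0 <= i < size D)
      angle (c (nth b (a' :: D) i)) (c (nth b (a' :: D) i.+1)) <= L b - L a'.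
  exact: sum_le.
elim: D a' {abD} => [|d D IH] a' aa' a'bD.
  by rewrite (itv_partition_nil a'bD) big_nil subrr.
have db := itv_partition_cons a'bD; have a'd : a' < d by case: a'bD => /= /andP[].
have le1 := Ladd a' d aa' a'd (itv_partition_le db).
have le2 := IH d (le_trans aa' (ltW a'd)) db.
by rewrite /= big_nat_recl//=; lra.
Qed.

End Length.

(** * Mean length of the projections of a polygon *)

Section ShortArcs.
Context {R : realType} {n : nat}.
Implicit Types (c : R -> 'rV[R]_n) (a b s t : R) (ts : seq R).

Definition orthonormal2 (x y : 'rV[R]_n) := [/\ dot x x = 1, dot y y = 1 & dot x y = 0].

(** An arc shorter than a half circle, on which the angle is additive. *)
Definition short_arc c a b := exists x y (theta : R -> R), [/\ orthonormal2 x y,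
  {in `[a, b] &, {homo theta : s t / s < t}},
  theta b - theta a < pi &
  forall s, s \in `[a, b] -> c s = circle x y (theta s)].

Lemma chain_impl (P Q : R -> R -> Prop) a ts :
  (forall s t, P s t -> Q s t) -> chain P a ts -> chain Q a ts.
Proof. by move=> PQ; elim: ts a => //= d ts IH a [/PQ ad /IH]. Qed.

Lemma chain_itv_partition (P : R -> R -> Prop) a b ts : itv_partition a b ts ->
  chain P a ts -> chain (fun s t => [/\ a <= s, s < t, t <= b & P s t]) a ts.
Proof.
move=> abts /(chain_nthP _ b) H; apply/(chain_nthP _ b) => i its; split.
- exact: itv_partition_nth_ge (ltnW its) abts.
- by have /itv_partition_chain/(chain_nthP _ b) := abts; apply.
- exact: itv_partition_nth_le abts.
- exact: H.
Qed.

(** Bisection with the intermediate value theorem. *)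
Lemma subdivision_increment (theta : R -> R) (m : nat) a b : a < b ->
  {within `[a, b], continuous theta} ->
  {in `[a, b] &, {homo theta : s t / s < t}} ->
  theta b - theta a < pi * 2 ^+ m ->
  exists ts, itv_partition a b ts /\
    chain (fun s t => theta t - theta s < pi) a ts.
Proof.
elim: m a b => [|m IH] a b ab cth incr small.
  exists [:: b]; split; first exact: itv_partition1.
  by move: small; rewrite expr0 mulr1.
have aI : a \in `[a, b] by rewrite in_itv/= lexx ltW.
have bI : b \in `[a, b] by rewrite in_itv/= lexx ltW.
have thab := incr _ _ aI bI ab.
have [d dI thd] : exists2 d, d \in `[a, b] & theta d = (theta a + theta b) / 2.
  apply: IVT => //; first exact: ltW.
  by rewrite (min_idPl (ltW thab)) (max_idPr (ltW thab)); lra.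
have /andP[lead ledb] : a <= d <= b by move: dI; rewrite in_itv.
have ad : a < d by rewrite lt_neqAle lead andbT; apply/eqP => adE; rewrite -adE in thd; lra.
have db : d < b by rewrite lt_neqAle ledb andbT; apply/eqP => dbE; rewrite dbE in thd; lra.
have sub1 : {subset `[a, d] <= `[a, b]}.
  by move=> s; rewrite !in_itv/= => /andP[-> sd]; exact: le_trans ledb.
have sub2 : {subset `[d, b] <= `[a, b]}.
  by move=> s; rewrite !in_itv/= => /andP[ds ->]; rewrite (le_trans lead).
rewrite exprS in small.
have [ts1 [p1 c1]] : exists ts, itv_partition a d ts /\
    chain (fun s t => theta t - theta s < pi) a ts.
  apply: IH => //; last by rewrite thd; lra.
    by apply: continuous_subspaceW cth => s /=; exact: sub1.
  by move=> s t /sub1 ? /sub1 ?; exact: incr.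
have [ts2 [p2 c2]] : exists ts, itv_partition d b ts /\
    chain (fun s t => theta t - theta s < pi) d ts.
  apply: IH => //; last by rewrite thd; lra.
    by apply: continuous_subspaceW cth => s /=; exact: sub2.
  by move=> s t /sub2 ? /sub2 ?; exact: incr.
exists (ts1 ++ ts2); split; first exact: itv_partition_cat p1 p2.
by apply: chain_cat => //; case: p1 => _ /eqP->.
Qed.

Lemma geodesic_arc_subdivision c a b : a < b -> geodesic_arc a b c ->
  exists ts, itv_partition a b ts /\ chain (short_arc c) a ts.
Proof.
move=> ab [x [y [theta [[x1 y1 xy] [cth incr cE]]]]].
pose m := Num.bound (theta b - theta a).
have aI : a \in `[a, b] by rewrite in_itv/= lexx ltW.
have bI : b \in `[a, b] by rewrite in_itv/= lexx ltW.
have thab := incr _ _ aI bI ab.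
have small : theta b - theta a < pi * 2 ^+ m.
  apply: lt_le_trans (archi_boundP _) _; first by rewrite subr_ge0 ltW.
  apply: (@le_trans _ _ (2 ^+ m)); first by rewrite -natrX ler_nat ltnW// ltn_expl.
  by rewrite ler_peMl ?exprn_ge0// (le_trans _ (pi_ge2 R))//; lra.
have [ts [abts dts]] := subdivision_increment ab cth incr small.
exists ts; split=> //; apply: chain_impl (chain_itv_partition abts dts) => s t [sa st tb inc].
have sub : {subset `[s, t] <= `[a, b]}.
  move=> u; rewrite !in_itv/= => /andP[su ut].
  by rewrite (le_trans sa su) (le_trans ut tb).
exists x, y, theta; split=> //.
- by split=> //; apply/enorm_eq1.
- by move=> u v /sub ? /sub ?; exact: incr.
- by move=> u /sub; exact: cE.
Qed.

Lemma polygonal_short_arcs c a b ts : polygonal a b c ts ->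
  exists ts', itv_partition a b ts' /\ chain (short_arc c) a ts'.
Proof.
move=> [abts /(chain_nthP (fun s t => geodesic_arc s t c)) arcs].
elim: ts a abts arcs => [|d ts IH] a abts /=; first by exists [::].
move=> [ad arcs]; have db := itv_partition_cons abts.
have ltad : a < d by case: abts => /= /andP[].
have [ts1 [p1 c1]] := geodesic_arc_subdivision ltad ad.
have [ts2 [p2 c2]] := IH d db arcs.
exists (ts1 ++ ts2); split; first exact: itv_partition_cat p1 p2.
by apply: chain_cat => //; case: p1 => _ /eqP->.
Qed.

Lemma short_arc_additive c x y (theta : R -> R) a b :
  {in `[a, b] &, {homo theta : s t / s < t}} -> theta b - theta a < pi ->
  (forall s, circle x y s != 0) ->
  (forall s, s \in `[a, b] -> normalize (c s) = normalize (circle x y (theta s))) ->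
  angle_additive_on c a b.
Proof.
move=> incr small nz cE s t r sa st tr rb.
have le_th : {in `[a, b] &, {homo theta : s t / s <= t}}.
  exact: ltW_homo_in.
have aI : a \in `[a, b] by rewrite in_itv/= lexx (le_trans sa)// (le_trans st)// (le_trans tr).
have bI : b \in `[a, b] by rewrite in_itv/= lexx (le_trans sa)// (le_trans st)// (le_trans tr).
have sI : s \in `[a, b] by rewrite in_itv/= sa (le_trans st)// (le_trans tr).
have tI : t \in `[a, b] by rewrite in_itv/= (le_trans sa)// (le_trans tr).
have rI : r \in `[a, b] by rewrite in_itv/= rb (le_trans sa)// (le_trans st).
rewrite -!(angle_normalize (c _) (c _)) !cE// !angle_normalize.
apply: angle_circle_add => //; [exact: le_th|exact: le_th|].
by have := le_th _ _ aI sI sa; have := le_th _ _ rI bI rb; lra.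
Qed.

Lemma short_arc_unit c a b s : short_arc c a b -> s \in `[a, b] -> dot (c s) (c s) = 1.
Proof. by move=> [x [y [th [[xx yy xy] _ _ cE]]]] /cE->; exact: circle_unit. Qed.

End ShortArcs.

Section MeanLength.
Context {R : realType} {n k : nat} {kn : (k <= n)%N}.
Local Notation G := (grassmannian R kn).
Variable mu : probability G R.
Hypotheses (mu_rot : rotation_invariant mu) (k2 : (1 < k)%N).

Lemma oproj_circle (p : {vspace 'rV[R]_n}) x y s :
  oproj p (circle x y s) = circle (oproj p x) (oproj p y) s.
Proof. by rewrite -!rproj0 /circle rprojD !rprojZ. Qed.

(** Almost every [p] projects the plane of [x] and [y] injectively: [x] does not
    project to [0], nor does [y] after removal of its component along the
    projection of [x]. *)
Lemma oproj_circle_ae_neq0 x y : orthonormal2 x y ->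
  \forall p \ae mu, forall s, circle (oproj (val p) x) (oproj (val p) y) s != 0.
Proof.
move=> [xx yy xy].
have x0 : x != 0 by rewrite -dot_eq0 xx oner_eq0.
have y0 : y != 0 by rewrite -dot_eq0 yy oner_eq0.
have aex : \forall p \ae mu, rproj (val p) 0 x != 0.
  by apply: rproj_ae_neq0 => //; exact: dot0l.
have aey : \forall p \ae mu, rproj (val p) x y != 0 by exact: rproj_ae_neq0.
apply: filterS (filterI aex aey) => p [/=]; rewrite rproj0 => px py s.
rewrite -oproj_circle; apply/eqP => c0.
have : rproj (val p) x (circle x y s) = 0 by rewrite /rproj c0 dot0l mul0r scale0r subr0.
rewrite /circle rprojD !rprojZ rproj_self scaler0 add0r => /eqP.
rewrite scaler_eq0 (negbTE py) orbF => /eqP s0.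
move: c0; rewrite /circle s0 scale0r addr0 -rproj0 rprojZ rproj0 => /eqP.
rewrite scaler_eq0 (negbTE px) orbF => /eqP c0.
by have := cos2Dsin2 s; rewrite s0 c0 expr0n/= addr0 => /eqP; rewrite eq_sym oner_eq0.
Qed.

Lemma short_arc_ae_additive c a b : short_arc c a b ->
  \forall p \ae mu, angle_additive_on (sproj (val p) \o c) a b.
Proof.
move=> [x [y [th [oxy incr small cE]]]].
apply: filterS (oproj_circle_ae_neq0 oxy) => p nz.
apply: short_arc_additive incr small nz _ => s sI.
by rewrite /= /sproj normalizeK cE// oproj_circle.
Qed.

Lemma short_arc_additive_self c a b : short_arc c a b ->
  @angle_additive_on R n c a b.
Proof.
move=> [x [y [th [[xx yy xy] incr small cE]]]].
apply: short_arc_additive incr small _ _ => [s|s /cE->//].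
by rewrite -dot_eq0 circle_unit// oner_eq0.
Qed.

Lemma curve_length_ge0 (c : R -> 'rV[R]_n) a b : a < b -> (0 <= curve_length a b c)%E.
Proof.
move=> ab; apply: (@le_trans _ _ (\sum_(0 <= i < size [:: b])
  angle (c (nth b (a :: [:: b]) i)) (c (nth b (a :: [:: b]) i.+1)))%:E).
  by rewrite lee_fin sumr_ge0// => i _; exact: angle_ge0.
by apply: ereal_sup_ubound; exists [:: b] => //; exact: itv_partition1.
Qed.

(** One partition into short arcs measures the length of the curve and of almost
    all its projections, so the mean angle formula can be summed over it. *)
Theorem mean_curve_length (c : R -> 'rV[R]_n) a b ts : a < b -> polygonal a b c ts ->
  curve_length a b c = (\int[mu]_p curve_length a b (sproj (val p) \o c))%E.
Proof.
move=> ab /polygonal_short_arcs[D [abD arcs]].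
pose e i := c (nth b (a :: D) i).
have arcs_nth := (chain_nthP (short_arc c) b a D).1 arcs.
have unit i : (i <= size D)%N -> (0 < size D)%N -> dot (e i) (e i) = 1.
  move=> iD D0.
  have lt_nth j : (j < size D)%N -> nth b (a :: D) j < nth b (a :: D) j.+1.
    by have /itv_partition_chain/(chain_nthP _ b) := abD; apply.
  have [{}iD|Di] := ltnP i (size D); last first.
    have jD : ((size D).-1 < size D)%N by rewrite ltn_predL.
    have -> : i = (size D).-1.+1 by rewrite prednK//; apply/eqP; rewrite eqn_leq iD.
    by apply: (short_arc_unit (arcs_nth _ jD)); rewrite in_itv/= lexx andbT ltW// lt_nth.
  by apply: (short_arc_unit (arcs_nth i iD)); rewrite in_itv/= lexx ltW// lt_nth.
rewrite (curve_length_chain abD); last exact: chain_impl (@short_arc_additive_self c) arcs.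
have meas i : measurable_fun setT (fun p : G =>
    (angle (rproj (val p) 0 (e i)) (rproj (val p) 0 (e i.+1)))%:E).
  exact: measurable_angle_rprojE.
transitivity (\int[mu]_p (\sum_(0 <= i < size D)
    (angle (rproj (val p) 0 (e i)) (rproj (val p) 0 (e i.+1)))%:E))%E.
  rewrite ge0_integral_sum//; last by move=> i p _; rewrite lee_fin angle_ge0.
  rewrite -sumEFin; apply: eq_big_nat => i /andP[_ iD].
  apply/esym; apply: mean_angle_rproj => //; rewrite ?dot0l//.
    by apply: unit; [exact: ltnW|exact: leq_ltn_trans iD].
  by apply: unit => //; exact: leq_ltn_trans iD.
apply/esym; apply: ge0_integral_ae_eq.
- by move=> p; exact: curve_length_ge0.
- by move=> p; apply: sume_ge0 => i _; rewrite lee_fin angle_ge0.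
- by apply: emeasurable_sum => i; exact: meas.
have : \forall p \ae mu, forall i : 'I_(size D),
    angle_additive_on (sproj (val p) \o c) (nth b (a :: D) i) (nth b (a :: D) i.+1).
  apply: filter_forall => i; apply: short_arc_ae_additive.
  exact: arcs_nth.
apply: filterS => p add; rewrite (curve_length_chain abD).
  rewrite -sumEFin; apply: eq_big_nat => i _; congr EFin.
  by rewrite /= /sproj angle_normalize !rproj0.
by apply/(chain_nthP _ b) => i iD; exact: (add (Ordinal iD)).
Qed.

End MeanLength.

(** * Directions of chords *)

Section ChordDirection.
Context {R : realType} {n : nat}.
Implicit Types (u v w x y e : 'rV[R]_n) (t h : R).

Definition rejection v u := u - (dot u v / dot v v) *: v.

Lemma dot_rejection v u : v != 0 -> dot v (rejection v u) = 0.
Proof.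
move=> v0; rewrite /rejection !dot_linear divfK ?dot_eq0//.
by rewrite dotC subrr.
Qed.

Lemma normalizeN v : normalize (- v) = - normalize v.
Proof. by rewrite /normalize /enorm dotNl dotNr opprK scalerN. Qed.

Lemma circle_shift x y t h :
  circle x y (t + h) = circle (circle x y t) (circle x y (t + pi / 2)) h.
Proof.
rewrite /circle cosDpihalf sinDpihalf cosD sinD.
by apply/rowP => i; rewrite !mxE; ring.
Qed.

Lemma circle_reverse x y t : circle x y (- t) = circle x (- y) t.
Proof. by rewrite /circle cosN sinN scaleNr scalerN. Qed.

(** If [u = k v], then [circle v u] vanishes at the angle [pi / 2 + atan k]. *)
Lemma rejection_neq0 v u : (forall t, circle v u t != 0) -> rejection v u != 0.
Proof.
move=> nz; apply/eqP => r0; set k := dot u v / dot v v.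
have uE : u = k *: v by apply/eqP; rewrite -subr_eq0 -/(rejection v u) r0.
have /eqP[] := nz (atan k + pi / 2); clearbody k.
rewrite /circle uE scalerA -scalerDl cosDpihalf sinDpihalf sin_atan.
by rewrite [cos _ * k]mulrC addNr scale0r.
Qed.

(** With [a] and [b] the cosine and the sine of an angle, the chord points in the
    direction [e2] turned by half of that angle. *)
Lemma normalize_chord e1 e2 (a b : R) :
  orthonormal2 e1 e2 -> a ^+ 2 + b ^+ 2 = 1 -> 0 < b ->
  normalize (a *: e1 + b *: e2 - e1) =
  - Num.sqrt ((1 - a) / 2) *: e1 + Num.sqrt ((1 + a) / 2) *: e2.
Proof.
move=> [d1 d2 d12] ab1 b0.
have [a1 a1'] : 0 < 1 - a /\ 0 < 1 + a by split; nra.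
set s := Num.sqrt ((1 - a) / 2); set r := Num.sqrt ((1 + a) / 2).
have ss : s ^+ 2 = (1 - a) / 2 by rewrite sqr_sqrtr// divr_ge0// ltW.
have rr : r ^+ 2 = (1 + a) / 2 by rewrite sqr_sqrtr// divr_ge0// ltW.
have s0 : 0 < s by rewrite sqrtr_gt0 divr_gt0.
have r0 : 0 < r by rewrite sqrtr_gt0 divr_gt0.
have bE : b = 2 * s * r.
  apply/eqP; rewrite -(@eqrXn2 _ 2)// ?(ltW b0) ?mulr_ge0 ?(ltW s0) ?(ltW r0)//.
  by rewrite !exprMn ss rr; apply/eqP; nra.
have aE : a - 1 = - (2 * s * s) by rewrite -mulrA -expr2 ss; field.
have -> : a *: e1 + b *: e2 - e1 = (2 * s) *: (- s *: e1 + r *: e2).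
  rewrite addrAC -{2}(scale1r e1) -scalerBl aE bE scalerDr !scalerA.
  by congr (_ *: _ + _); ring.
rewrite normalizeZ ?mulr_gt0// normalize_id//.
rewrite !dot_linear d1 d2 (dotC e2) d12 !mulr0 !mulr1 addr0 add0r.
by rewrite mulrNN -!expr2 ss rr; field.
Qed.

(** In the orthonormal basis obtained from [v] and [u] by the Gram-Schmidt process,
    the curve [normalize (circle v u h)] has the coordinates [a h], which tends to
    [1], and a positive number; so the exact formula for the direction of the chord
    can be used instead of a derivative. *)
Lemma chord_direction_cvg v u : (forall t, circle v u t != 0) ->
  normalize (normalize (circle v u h) - normalize v) @[h --> 0^'+] -->
  normalize (rejection v u).
Proof.
move=> nz; have v0 : v != 0 by have := nz 0; rewrite circle0.
have rej0 := rejection_neq0 nz.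
set e1 := normalize v; set e2 := normalize (rejection v u).
have [rho lam] := (enorm_gt0 v, enorm_gt0 (rejection v u)).
rewrite v0 rej0 in rho lam.
have vE : v = enorm v *: e1 by rewrite scalerA divff ?scale1r ?gt_eqF.
have [kap uE] : exists kap, u = kap *: e1 + enorm (rejection v u) *: e2.
  exists (dot u v / dot v v * enorm v).
  by rewrite -scalerA -vE scalerA divff ?gt_eqF// scale1r addrC subrK.
have on : orthonormal2 e1 e2.
  split; rewrite /e1 /e2 ?dot_normalize ?v0 ?rej0//.
  by rewrite dotZl dotZr dot_rejection// !mulr0.
move: (enorm v) (enorm (rejection v u)) => r1 r2 in rho lam vE uE *.
clearbody e1 e2.
pose f h : R := cos h * r1 + sin h * kap; pose g h : R := sin h * r2.
have cE h : circle v u h = f h *: e1 + g h *: e2.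
  rewrite /circle vE uE scalerDr !scalerA addrA -scalerDl.
  by congr (_ *: _ + _).
have normE h : enorm (circle v u h) = Num.sqrt (f h ^+ 2 + g h ^+ 2).
  rewrite /enorm cE; case: on => d1 d2 d12.
  by rewrite !dot_linear d1 d2 (dotC e2) d12; congr Num.sqrt; ring.
pose a h := f h / Num.sqrt (f h ^+ 2 + g h ^+ 2).
have fc : f h @[h --> 0] --> r1.
  have -> : r1 = f 0 by rewrite /f cos0 sin0 mul1r mul0r addr0.
  by apply: cvgD; apply: cvgMr_tmp; [exact: continuous_cos|exact: continuous_sin].
have gc : g h @[h --> 0] --> (0 : R).
  have g0 : g 0 = 0 by rewrite /g sin0 mul0r.
  suff : g h @[h --> 0] --> g 0 by rewrite g0.
  by apply: cvgMr_tmp; exact: continuous_sin.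
have ac : a h @[h --> 0^'+] --> (1 : R).
  apply: cvg_at_right_filter.
  have -> : 1 = r1 / Num.sqrt (r1 ^+ 2 + 0 ^+ 2).
    by rewrite expr0n addr0 sqrtr_sqr gtr0_norm// divff// gt_eqF.
  apply: cvgM => //; apply: cvgV.
    by rewrite expr0n addr0 sqrtr_sqr gtr0_norm// gt_eqF.
  apply: (continuous_cvg _ (@sqrt_continuous _ _)).
  by apply: cvgD; rewrite !expr2; apply: cvgM.
have ev : \forall h \near 0^'+,
    - Num.sqrt ((1 - a h) / 2) *: e1 + Num.sqrt ((1 + a h) / 2) *: e2 =
    normalize (normalize (circle v u h) - e1).
  near=> h.
  have sin0 : 0 < sin h.
    by rewrite sin_gt0_pi//; apply/andP; split; near: h;
      [exact: nbhs_right_gt|apply: nbhs_right_lt; exact: pi_gt0].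
  have r0 : 0 < Num.sqrt (f h ^+ 2 + g h ^+ 2) by rewrite -normE enorm_gt0.
  have rr : Num.sqrt (f h ^+ 2 + g h ^+ 2) ^+ 2 = f h ^+ 2 + g h ^+ 2.
    by rewrite sqr_sqrtr// addr_ge0 ?sqr_ge0.
  have -> : normalize (circle v u h) =
      a h *: e1 + (g h / Num.sqrt (f h ^+ 2 + g h ^+ 2)) *: e2.
    by rewrite /normalize normE cE scalerDr !scalerA ![_^-1 * _]mulrC.
  rewrite normalize_chord//.
  - by rewrite /a !expr_div_n -mulrDl rr divff// -rr sqrf_eq0 gt_eqF.
  - by rewrite divr_gt0// mulr_gt0.
apply: cvg_trans (near_eq_cvg ev) _.
have ca : - Num.sqrt ((1 - a h) / 2) @[h --> 0^'+] --> (0 : R).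
  have lim0 : - Num.sqrt ((1 - 1) / 2) = 0 :> R by rewrite subrr mul0r sqrtr0 oppr0.
  suff : - Num.sqrt ((1 - a h) / 2) @[h --> 0^'+] --> - Num.sqrt ((1 - 1 : R) / 2).
    by rewrite lim0.
  apply: cvgN; apply: (continuous_cvg _ (@sqrt_continuous _ _)).
  by apply: cvgMr_tmp; apply: cvgB => //; exact: cvg_cst.
have cb : Num.sqrt ((1 + a h) / 2) @[h --> 0^'+] --> (1 : R).
  have lim1 : Num.sqrt ((1 + 1) / 2) = 1 :> R by rewrite divff ?sqrtr1.
  suff : Num.sqrt ((1 + a h) / 2) @[h --> 0^'+] --> Num.sqrt ((1 + 1 : R) / 2).
    by rewrite lim1.
  apply: (continuous_cvg _ (@sqrt_continuous _ _)).
  by apply: cvgMr_tmp; apply: cvgD => //; exact: cvg_cst.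
have lim : (- Num.sqrt ((1 - a h) / 2) *: e1 + Num.sqrt ((1 + a h) / 2) *: e2)
    @[h --> 0^'+] --> (0 : R) *: e1 + (1 : R) *: e2.
  exact: (cvgD (cvgZr_tmp ca) (cvgZr_tmp cb)).
by rewrite scale0r add0r scale1r in lim.
Unshelve. all: by end_near. Qed.

End ChordDirection.

(** * One-sided tangents *)

Section Tangents.
Context {R : realType} {n : nat}.
Implicit Types (c : R -> 'rV[R]_n) (x y u v : 'rV[R]_n) (a b s t h : R).

Lemma cvg_to_at_right (F : set_system R) (f : R -> R) a : Filter F ->
  f h @[h --> F] --> a -> (\forall h \near F, a < f h) -> f h @[h --> F] --> a^'+.
Proof.
move=> FF fa af A /= Aa; have := fa _ Aa; rewrite /= nbhs_simpl /=.
by move=> H; apply: filterS2 af H => h /= ah; apply.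
Qed.

Lemma rejectionN v u : rejection v (- u) = - rejection v u.
Proof. by rewrite /rejection dotNl mulNr scaleNr opprK opprD opprK. Qed.

(** The increment of [theta] tends to [0] from the right whatever the
    parametrization, and by [circle_shift] the chord is that of a circle that
    starts at [circle x y (theta s)]. *)
Lemma tangent_right_circle c x y (theta : R -> R) s b : s < b ->
  {within `[s, b], continuous theta} ->
  {in `[s, b] &, {homo theta : t r / t < r}} ->
  (forall t, circle x y t != 0) ->
  (forall t, t \in `[s, b] -> c t = normalize (circle x y (theta t))) ->
  tangent_right c s =
  normalize (rejection (circle x y (theta s)) (circle x y (theta s + pi / 2))).
Proof.
move=> sb cth incr nz cE; apply: cvg_lim; first exact: norm_hausdorff.
set v := circle x y (theta s); set u := circle x y _.
have sI : s \in `[s, b] by rewrite in_itv/= lexx ltW.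
have shift h : circle x y (theta s + h) = circle v u h by exact: circle_shift.
have nzvu h : circle v u h != 0 by rewrite -shift.
have [_ ths _] := (continuous_within_itvP _ sb).1 cth.
pose d h := theta (s + h) - theta s.
have small : \forall h \near 0^'+, 0 < h /\ s + h \in `[s, b].
  near=> h; have h0 : 0 < h by near: h; exact: nbhs_right_gt.
  split=> //; rewrite in_itv/= lerDl ltW//= -lerBrDl.
  by near: h; apply: nbhs_right_le; rewrite subr_gt0.
have dc : d h @[h --> 0^'+] --> 0^'+.
  apply: cvg_to_at_right; last first.
    by apply: filterS small => h [h0 hI]; rewrite subr_gt0 incr// ltrDl.
  suff : d h @[h --> 0^'+] --> theta s - theta s by rewrite subrr.
  apply: cvgB; last exact: cvg_cst.
  by move=> A /ths/= /nbhs_right0P.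
have lim := cvg_comp _ _ dc (chord_direction_cvg nzvu).
apply: cvg_trans lim; apply: near_eq_cvg.
apply: filterS small => h [h0 hI] /=.
by rewrite !cE// -shift /d (addrC (theta s)) subrK.
Unshelve. all: by end_near. Qed.

(** Reversing the circle turns the arrival at [s] into a departure. *)
Lemma tangent_left_circle c x y (theta : R -> R) a s : a < s ->
  {within `[a, s], continuous theta} ->
  {in `[a, s] &, {homo theta : t r / t < r}} ->
  (forall t, circle x y t != 0) ->
  (forall t, t \in `[a, s] -> c t = normalize (circle x y (theta t))) ->
  tangent_left c s =
  normalize (rejection (circle x y (theta s)) (circle x y (theta s + pi / 2))).
Proof.
move=> sa cth incr nz cE; apply: cvg_lim; first exact: norm_hausdorff.
set v := circle x y (theta s); set u := circle x y _.
have sI : s \in `[a, s] by rewrite in_itv/= lexx ltW.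
have shift h : circle x y (theta s - h) = circle v (- u) h.
  by rewrite circle_shift circle_reverse.
have nzvu h : circle v (- u) h != 0 by rewrite -shift.
have [_ _ ths] := (continuous_within_itvP _ sa).1 cth.
pose d h := theta s - theta (s - h).
have small : \forall h \near 0^'+, 0 < h /\ s - h \in `[a, s].
  near=> h; have h0 : 0 < h by near: h; exact: nbhs_right_gt.
  split=> //; rewrite in_itv/= gerBl (ltW h0) andbT lerBrDr -lerBrDl.
  by near: h; apply: nbhs_right_le; rewrite subr_gt0.
have dc : d h @[h --> 0^'+] --> 0^'+.
  apply: cvg_to_at_right; last first.
    by apply: filterS small => h [h0 hI]; rewrite subr_gt0 incr// gtrBl.
  suff : d h @[h --> 0^'+] --> theta s - theta s by rewrite subrr.
  apply: cvgB; first exact: cvg_cst.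
  by move=> A /ths/= /nbhs_left0P.
have lim : - normalize (normalize (circle v (- u) (d h)) - normalize v)
    @[h --> 0^'+] --> normalize (rejection v u).
  rewrite -[normalize (rejection v u)]opprK -(normalizeN (rejection v u)) -rejectionN.
  apply: cvgN; exact: (cvg_comp _ _ dc (chord_direction_cvg nzvu)).
apply: cvg_trans lim; apply: near_eq_cvg.
apply: filterS small => h [h0 hI] /=.
rewrite !cE// -normalizeN opprB -shift /d.
by rewrite (opprB (theta s)) (addrC _ (_ - _)) subrK.
Unshelve. all: by end_near. Qed.

End Tangents.

(** * Mean geodesic rotation of the projections *)

Section MeanRotation.
Context {R : realType} {n k : nat} {kn : (k <= n)%N}.
Local Notation G := (grassmannian R kn).
Variable mu : probability G R.
Hypotheses (mu_rot : rotation_invariant mu) (k2 : (1 < k)%N).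
Implicit Types (c : R -> 'rV[R]_n) (x y u v : 'rV[R]_n) (a b s t : R).

Local Notation mean v a b :=
  (\int[mu]_p (angle (rproj (val p) v a) (rproj (val p) v b))%:E)%E.

(** The tangents of the projected curve at the image of a vertex [v] are normalised
    rejections from [oproj p v]; so [rproj p v] maps the tangents at [v] to positive
    multiples of them. *)
Lemma rejection_oproj (p : {vspace 'rV[R]_n}) v u :
  rejection (oproj p v) (oproj p u) = rproj p v u.
Proof. by rewrite /rejection /rproj !dot_oproj. Qed.

Lemma dot_circle_quarter x y t : orthonormal2 x y ->
  dot (circle x y t) (circle x y (t + pi / 2)) = 0.
Proof.
move=> [xx yy xy]; rewrite /circle cosDpihalf sinDpihalf !dot_linear xx yy.
by rewrite (dotC y) xy; ring.
Qed.

(** [tan] stands for the left or the right tangent at [s], the hypothesis for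
    [tangent_left_circle] or [tangent_right_circle]; it is applied to the curve and
    to almost all its projections. *)
Lemma arc_tangent (tan : (R -> 'rV[R]_n) -> 'rV[R]_n) c a b s : s \in `[a, b] ->
  (forall c' x y (theta : R -> R),
    {within `[a, b], continuous theta} ->
    {in `[a, b] &, {homo theta : t r / t < r}} ->
    (forall t, circle x y t != 0) ->
    (forall t, t \in `[a, b] -> c' t = normalize (circle x y (theta t))) ->
    tan c' = normalize (rejection (circle x y (theta s))
                                  (circle x y (theta s + pi / 2)))) ->
  geodesic_arc a b c ->
  [/\ dot (tan c) (tan c) = 1, dot (c s) (tan c) = 0 &
    \forall p \ae mu,
      tan (sproj (val p) \o c) = normalize (rproj (val p) (c s) (tan c))].
Proof.
move=> sI tanE [x [y [theta [[/enorm_eq1 xx /enorm_eq1 yy xy] [cth incr cE]]]]].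
have oxy : orthonormal2 x y by [].
have unit t : dot (circle x y t) (circle x y t) = 1 by exact: circle_unit.
have nz t : circle x y t != 0 by rewrite -dot_eq0 unit oner_eq0.
have tanc : tan c = circle x y (theta s + pi / 2).
  rewrite (tanE c x y theta cth incr nz); last by move=> t /cE ->; rewrite normalize_id.
  by rewrite /rejection dotC dot_circle_quarter// mul0r scale0r subr0 normalize_id.
rewrite tanc unit cE// dot_circle_quarter//; split=> //.
apply: filterS (oproj_circle_ae_neq0 mu_rot k2 oxy) => p nzp.
rewrite (tanE _ (oproj (val p) x) (oproj (val p) y) theta cth incr nzp).
  by rewrite -!oproj_circle rejection_oproj.
by move=> t /cE ct; rewrite /= ct /sproj oproj_circle.
Qed.

Lemma vertex_turning_angle c a s b : a < s -> s < b ->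
  geodesic_arc a s c -> geodesic_arc s b c ->
  let v := c s in let tl := tangent_left c s in let tr := tangent_right c s in
  mean v tl tr = (turning_angle c s)%:E /\
  \forall p \ae mu, turning_angle (sproj (val p) \o c) s =
    angle (rproj (val p) v tl) (rproj (val p) v tr).
Proof.
move=> lt_as sb arcl arcr v tl tr.
have [ll vl ael] : [/\ dot tl tl = 1, dot v tl = 0 & \forall p \ae mu,
    tangent_left (sproj (val p) \o c) s = normalize (rproj (val p) v tl)].
  apply: (@arc_tangent (fun c' => tangent_left c' s) c a s s) => //.
    by rewrite in_itv/= lexx ltW.
  by move=> c' x y theta; exact: tangent_left_circle.
have [rr vr aer] : [/\ dot tr tr = 1, dot v tr = 0 & \forall p \ae mu,
    tangent_right (sproj (val p) \o c) s = normalize (rproj (val p) v tr)].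
  apply: (@arc_tangent (fun c' => tangent_right c' s) c s b s) => //.
    by rewrite in_itv/= lexx ltW.
  by move=> c' x y theta; exact: tangent_right_circle.
split; first exact: mean_angle_rproj.
apply: filterS (filterI ael aer) => p [/= pl pr].
by rewrite /turning_angle pl pr angle_normalize.
Qed.

Lemma polygonal_vertex c a b ts s : polygonal a b c ts -> s \in ts -> s < b ->
  exists a' b', [/\ a' < s, s < b', geodesic_arc a' s c & geodesic_arc s b' c].
Proof.
move=> [abts arcs] sts sb; have lt_nth := (chain_nthP _ b a ts).1 (itv_partition_chain abts).
have its : (index s ts < size ts)%N by rewrite index_mem.
have sE : nth b (a :: ts) (index s ts).+1 = s by rewrite /= nth_index.
have its1 : ((index s ts).+1 < size ts)%N.
  rewrite ltn_neqAle its andbT; apply/eqP => iE.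
  by move: sb; rewrite -sE iE (itv_partition_nth_size _ abts) ltxx.
exists (nth b (a :: ts) (index s ts)), (nth b (a :: ts) (index s ts).+2).
have := arcs _ its; have := arcs _ its1; have := lt_nth _ its; have := lt_nth _ its1.
by rewrite sE.
Qed.

Theorem mean_geodesic_rotation c a b ts : polygonal a b c ts ->
  ((geodesic_rotation b c ts)%:E =
   \int[mu]_p (geodesic_rotation b (sproj (val p) \o c) ts)%:E)%E.
Proof.
move=> poly; rewrite /geodesic_rotation.
pose ts' := [seq s <- ts | s < b].
have vertex s : s \in ts' -> mean (c s) (tangent_left c s) (tangent_right c s)
      = (turning_angle c s)%:E /\
    \forall p \ae mu, turning_angle (sproj (val p) \o c) s =
      angle (rproj (val p) (c s) (tangent_left c s))
            (rproj (val p) (c s) (tangent_right c s)).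
  rewrite mem_filter => /andP[sb sts].
  have [a' [b' [a's sb' arcl arcr]]] := polygonal_vertex poly sts sb.
  exact: vertex_turning_angle arcl arcr.
pose f s (p : G) := (angle (rproj (val p) (c s) (tangent_left c s))
                     (rproj (val p) (c s) (tangent_right c s)))%:E.
have mf s : measurable_fun setT (f s) by exact: measurable_angle_rprojE.
have f0 s p : (0 <= f s p)%E by rewrite lee_fin angle_ge0.
transitivity (\int[mu]_p (\sum_(s <- ts') f s p))%E.
  rewrite ge0_integral_sum// -big_filter -sumEFin.
  by apply: eq_big_seq => s /vertex[<- _].
apply/esym; apply: ge0_integral_ae_eq.
- by move=> p; rewrite lee_fin sumr_ge0// => s _; exact: angle_ge0.
- by move=> p; exact: sume_ge0.
- exact: emeasurable_sum.
have : \forall p \ae mu, forall s : seq_sub ts',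
    turning_angle (sproj (val p) \o c) (ssval s) =
      angle (rproj (val p) (c (ssval s)) (tangent_left c (ssval s)))
            (rproj (val p) (c (ssval s)) (tangent_right c (ssval s))).
  by apply: filter_forall => s; exact: (vertex _ (ssvalP s)).2.
apply: filterS => p turn; rewrite -big_filter -sumEFin.
by apply: eq_big_seq => s sts; rewrite (turn (SeqSub sts)).
Qed.

End MeanRotation.

(** * Length and geodesic rotation as means *)

Theorem theorem4p4 (R : realType) (N j : nat)
    (N2 : (2 <= N)%N) (j1 : (1 <= j)%N) (jN : (j.+1 <= N)%N)
    (mu : probability (grassmannian R (leqW jN : (j.+1 <= N.+1)%N)) R)
    (mu_rot : rotation_invariant mu)
    (gamma : R -> 'rV[R]_N.+1) (ts : seq R)
    (gamma_poly : polygonal 0 1 gamma ts) :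
  (curve_length 0 1 gamma =
     \int[mu]_p curve_length 0 1 (sproj (val p) \o gamma))%E /\
  ((geodesic_rotation 1 gamma ts)%:E =
     \int[mu]_p (geodesic_rotation 1 (sproj (val p) \o gamma) ts)%:E)%E.
Proof.
split.
  exact: (mean_curve_length mu_rot _ ltr01 gamma_poly).
exact: (mean_geodesic_rotation mu_rot _ gamma_poly).
Qed.
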